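(* The inequality $\mathrm{ET}_{1}(e)$ is satisfied, and the constant $e$ is sharp. That is: for all log-concave probability measures $\eta_1,\eta_2$ on $\mathbb{R}$ having essentially continuous densities, with moment measures $\nu_1,\nu_2$, \[ H(\eta_1)+H(\eta_2)\le -\log(e\cdot e^2)+\mathcal{T}(\nu_1,\nu_2)=-3+\mathcal{T}(\nu_1,\nu_2), \] and for every $c>e$ the inequality $H(\eta_1)+H(\eta_2)\le-\log(ce^2)+\mathcal{T}(\nu_1,\nu_2)$ fails for some such pair $\eta_1,\eta_2$.
   Context: A probability measure $\eta$ on $\mathbb{R}$ is log-concave if it has a density with respect to Lebesgue measure of the form $e^{-V}$, where $V:\mathbb{R}\to\mathbb{R}\cup\{+\infty\}$ is convex and lower semicontinuous; $V$ is called the potential of $\eta$. It has an essentially continuous density if $e^{-V(x)}=0$ at every point $x$ of the boundary of the support of $\eta$. The moment measure of $\eta$ is the pushforward $\nu=V'\#\eta$ of $\eta$ under the ($\eta$-almost everywhere defined) derivative $V'$. Relative entropy: $H(\eta)=\int \log\left(\frac{d\eta}{dx}\right)d\eta$. Let $\mathcal{F}(\mathbb{R})$ be the set of convex lower semicontinuous functions $f:\mathbb{R}\to\mathbb{R}\cup\{+\infty\}$ taking at least one finite value, and $f^*(y)=\sup_{x}\{xy-f(x)\}$ the Fenchel-Legendre transform. For Borel probability measures $\mu_1,\mu_2$ on $\mathbb{R}$ with finite first moment, \[ \mathcal{T}(\mu_1,\mu_2)=\inf_{f\in\mathcal{F}(\mathbb{R})}\left\{\int f\,d\mu_1+\int f^*\,d\mu_2\right\}.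 \] For $c>0$, $\mathrm{ET}_{1}(c)$ is the statement: $H(\eta_1)+H(\eta_2)\le-\log(ce^2)+\mathcal{T}(\nu_1,\nu_2)$ for all log-concave probability measures $\eta_1,\eta_2$ on $\mathbb{R}$ with essentially continuous densities, $\nu_1,\nu_2$ being their moment measures. *)

(* Defs.v *)
From HB Require Import structures.
From mathcomp Require Import all_boot all_order all_algebra.
From mathcomp Require Import all_classical all_reals all_analysis.
Set Implicit Arguments.
Unset Strict Implicit.
Unset Printing Implicit Defensive.
Import Order.TTheory GRing.Theory Num.Theory.
Import numFieldNormedType.Exports.
Local Open Scope classical_set_scope.
Local Open Scope ring_scope.

Section Defs.
Context {R : realType}.

Local Notation borelR := (measurableTypeR R).
Local Notation lebesgue := (@lebesgue_measure R).

(* Functions R -> \bar R never taking the value -oo, i.e. with values in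
   R U {+oo}. With the library's convention 0 * +oo = 0, the endpoints
   t = 0 and t = 1 are harmless. *)
Definition convex_lsc (f : R -> \bar R) : Prop :=
  [/\ forall x, (-oo < f x)%E,
      forall (t x y : R), 0 <= t <= 1 ->
        (f (t * x + (1 - t) * y)%R <= t%:E * f x + (1 - t)%R%:E * f y)%E
    & lower_semicontinuous f].

Definition proper_convex_lsc : set (R -> \bar R) :=
  [set f | convex_lsc f /\ exists x, (f x < +oo)%E].

Definition fenchel (f : R -> \bar R) (y : R) : \bar R :=
  ereal_sup [set ((x * y)%:E - f x)%E | x in [set: R]].

(* V may be +oo, where the density expeR (- V x) vanishes. *)
Definition is_potential (eta : probability borelR R) (V : R -> \bar R) : Prop :=
  convex_lsc V /\
  forall A : set borelR, measurable A ->
    eta A = (\int[lebesgue]_(x in A) expeR (- V x))%E.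

Definition msupport (eta : probability borelR R) : set R :=
  [set x | forall U : set R, open U -> U x -> (0 < eta U)%E].

Definition essentially_continuous (eta : probability borelR R)
    (V : R -> \bar R) : Prop :=
  forall x, (closure (msupport eta) `\` (msupport eta)°) x ->
    expeR (- V x) = 0%E.

(* derive1 (fine \o V) agrees with V' wherever V is finite near x and
   differentiable at x, hence eta-almost everywhere when V is the potential
   of eta; its values elsewhere are irrelevant. *)
Definition is_moment_measure (eta : probability borelR R) (V : R -> \bar R)
    (nu : probability borelR R) : Prop :=
  forall A : set borelR, measurable A ->
    nu A = pushforward eta (derive1 (fine \o V) : borelR -> borelR) A.

Definition log_concave_ec (eta nu : probability borelR R) : Prop :=
  exists V : R -> \bar R, [/\ is_potential eta V,
    essentially_continuous eta V & is_moment_measure eta V nu].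

Definition entropy (eta : probability borelR R) : \bar R :=
  (\int[eta]_x lne (Radon_Nikodym (charge_of_finite_measure eta) lebesgue x))%E.

(* For mu1, mu2 with finite first moments, which moment measures have, both
   integrals are well defined in ]-oo, +oo]. *)
Definition transport (mu1 mu2 : probability borelR R) : \bar R :=
  ereal_inf [set (\int[mu1]_x f x + \int[mu2]_y fenchel f y)%E
            | f in proper_convex_lsc].

Definition ET_ineq (c : R) (eta1 eta2 nu1 nu2 : probability borelR R) : Prop :=
  (entropy eta1 + entropy eta2
     <= (- ln (c * expR 1 ^+ 2))%R%:E + transport nu1 nu2)%E.

Definition ET1 (c : R) : Prop :=
  forall eta1 eta2 nu1 nu2 : probability borelR R,
    log_concave_ec eta1 nu1 -> log_concave_ec eta2 nu2 ->
    ET_ineq c eta1 eta2 nu1 nu2.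

End Defs.

(* Main.v *)
From HB Require Import structures.
Require Import Defs.
From mathcomp Require Import all_boot all_order all_algebra.
From mathcomp Require Import all_classical all_reals all_analysis.
From mathcomp Require Import measurable_realfun ring lra.
Set Implicit Arguments.
Unset Strict Implicit.
Unset Printing Implicit Defensive.
Import Order.TTheory GRing.Theory Num.Theory.
Import numFieldNormedType.Exports.
Local Open Scope classical_set_scope.
Local Open Scope ring_scope.

(** Write eta_i = exp (- V_i) dx, let F_i be its distribution function and, for
    t in ]0, 1[, let x_i be the point where F_i x_i = t.  The cost of any
    admissible f is bounded from below for each t separately:

      int f dnu_1 + int f^* dnu_2
        >= exp (- V_1 x_1) exp (- V_2 x_2) / (t (1 - t)).

    To see this, cut the line at x_i into two blocks, of eta_i-mass t and
    1 - t.  Averaging f a + f^* b >= a b with a = V_1' and b = V_2' over the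
    product of the two left blocks, then over the product of the two right
    blocks, bounds the cost by t A_1 A_2 + (1 - t) B_1 B_2, where A_i and B_i
    are the averages of V_i' over the blocks ([young_block]); no optimal
    coupling is needed.  Since (exp (- V))' = - V' exp (- V), and exp (- V)
    vanishes at both ends by essential continuity, V_i' integrates to
    - exp (- V_i x_i) over the left block and to exp (- V_i x_i) over the right
    one ([slope_block_left], [slope_block_right]).

    Now let K be the cost, take logarithms and integrate over t.  Under the
    uniform law x_i has law eta_i ([quant_law]), so - V_i x_i integrates to the
    entropy of eta_i, while - ln t - ln (1 - t) integrates to 2.  Hence
    H (eta_1) + H (eta_2) + 2 <= ln K <= K - 1.

    A convex V is differentiable only off a countable set.  All computations
    use its right derivative, [slope], which is Borel because it is monotone;
    the derivative of V differs from it on a countable, hence Borel and null,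
    set, so that both have the same push-forward of eta.

    For the sharpness, take the density exp (- max (- a x) (b x)) with
    1 / a + 1 / b = 1 and its mirror image.  Both entropies are - 1, the moment
    measures have two atoms each, and a convex f with the two slopes - b and a
    shows that the transport cost is at most a ^ 2 ([transport_laplace_le]).
    When a tends to 1, the bound - ln (c e ^ 2) + a ^ 2 tends to - 1 - ln c,
    which is smaller than - 2 as soon as c > e. *)


(** * Convex potentials and their right derivative *)

Section ConvexPotential.
Context {R : realType}.
Variable V : R -> \bar R.
Hypothesis cV : convex_lsc V.

(** The interior of the domain of V, written without closures so that
    convexity can be applied to the two witnesses. *)
Definition idom : set R :=
  [set x | exists y z, [/\ y < x, x < z, (V y < +oo)%E & (V z < +oo)%E]].

Definition rpot (x : R) : R := fine (V x).

Lemma potential_fin x : (V x < +oo)%E -> V x = (rpot x)%:E.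
Proof.
by case: cV => + _ _ => /(_ x) Vx Vxy; rewrite /rpot fineK// fin_numElt Vx.
Qed.

(** The chord inequality is multiplied out, which avoids any division in its
    uses. *)
Lemma potential_chord y x z : y < x -> x < z -> (V y < +oo)%E -> (V z < +oo)%E ->
  (V x < +oo)%E /\
  (rpot x - rpot y) * (z - x) <= (rpot z - rpot x) * (x - y).
Proof.
move=> yx xz Vy Vz.
have zy : 0 < z - y by rewrite subr_gt0 (lt_trans yx).
pose t := (z - x) / (z - y).
have t01 : 0 <= t <= 1.
  apply/andP; split; first by rewrite divr_ge0 ?subr_ge0 ?ltW// -subr_gt0.
  by rewrite ler_pdivrMr// mul1r; lra.
case: (cV) => _ /(_ t y z t01) + _.
have -> : t * y + (1 - t) * z = x by rewrite /t; field; rewrite gt_eqF.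
rewrite (potential_fin Vy) (potential_fin Vz) -!EFinM -EFinD => Vx.
have Vxoo : (V x < +oo)%E by apply: le_lt_trans Vx _; rewrite ltry.
split => //; move: Vx; rewrite (potential_fin Vxoo) lee_fin => Vx.
have := ler_wpM2l (ltW zy) Vx.
have -> : (z - y) * (t * rpot y + (1 - t) * rpot z) =
  (z - x) * rpot y + (x - y) * rpot z by rewrite /t; field; rewrite gt_eqF.
lra.
Qed.

Lemma idom_fin x : idom x -> (V x < +oo)%E.
Proof. by move=> [y [z [yx xz Vy Vz]]]; have [] := potential_chord yx xz Vy Vz. Qed.

Lemma idom_itv x z y : idom x -> idom z -> x <= y -> y <= z -> idom y.
Proof.
move=> [a [_ [ax _ Va _]]] [_ [b [_ zb _ Vb]]] xy yz.
by exists a, b; split => //; [exact: lt_le_trans xy|exact: le_lt_trans zb].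
Qed.

Lemma idom_mid y z : y < z -> (V y < +oo)%E -> (V z < +oo)%E ->
  idom ((y + z) / 2).
Proof. by move=> yz Vy Vz; exists y, z; split => //; lra. Qed.

Lemma idom_left x : idom x -> exists2 u, idom u & u < x.
Proof.
move=> dx; have Vx := idom_fin dx; case: dx => y [z [yx xz Vy Vz]].
by exists ((y + x) / 2); [exact: idom_mid|lra].
Qed.

Lemma idom_right x : idom x -> exists2 w, idom w & x < w.
Proof.
move=> dx; have Vx := idom_fin dx; case: dx => y [z [yx xz Vy Vz]].
by exists ((x + z) / 2); [exact: idom_mid|lra].
Qed.

(** The right derivative of V: difference quotients of a convex function are
    monotone, so their limit is their infimum. *)
Definition rslope (x : R) : R :=
  inf [set (rpot w - rpot x) / (w - x) | w in [set w | idom w /\ x < w]].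

(** These inequalities hold for any selection of the subdifferential; they give
    the monotonicity of the slope, the derivative of V and its growth. *)
Lemma rslope_bounds x w : idom x -> idom w -> x < w ->
  rslope x * (w - x) <= rpot w - rpot x <= rslope w * (w - x).
Proof.
move=> dx dw xw; have wx : 0 < w - x by rewrite subr_gt0.
have lb u v z : idom u -> idom v -> idom z -> u < v -> v < z ->
    (rpot v - rpot u) / (v - u) <= (rpot z - rpot v) / (z - v).
  move=> du dv dz uv vz; rewrite ler_pdivrMr ?subr_gt0// mulrAC.
  rewrite ler_pdivlMr ?subr_gt0//.
  by have [] := potential_chord uv vz (idom_fin du) (idom_fin dz).
have hl u v : idom u -> idom v -> u < v -> lbound
    [set (rpot z - rpot v) / (z - v) | z in [set z | idom z /\ v < z]]
    ((rpot v - rpot u) / (v - u)).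
  by move=> du dv uv _ [z [dz vz] <-]; exact: lb.
apply/andP; split.
  rewrite -ler_pdivlMr//; apply: inf_lbound; last by exists w.
  have [u du ux] := idom_left dx; exists ((rpot x - rpot u) / (x - u)).
  exact: hl.
rewrite -ler_pdivrMr//; apply: lb_le_inf; last exact: hl.
have [z dz wz] := idom_right dw.
by exists ((rpot z - rpot w) / (z - w)); exists z.
Qed.

Lemma rslope_nd x w : idom x -> idom w -> x <= w -> rslope x <= rslope w.
Proof.
move=> dx dw; rewrite le_eqVlt => /orP[/eqP->//|xw].
have /andP[h1 h2] := rslope_bounds dx dw xw.
by have := le_trans h1 h2; rewrite ler_pM2r// subr_gt0.
Qed.

End ConvexPotential.

(** * The derivative of a convex potential off a countable set *)

Section Slope.
Context {R : realType}.
Variable V : R -> \bar R.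
Hypothesis cV : convex_lsc V.

Local Notation I := (idom V).

Lemma idom_interval : is_interval I.
Proof. by move=> x z dx dz y /andP[xy yz]; exact: idom_itv dx dz xy yz. Qed.

Lemma measurable_idom : measurable I.
Proof. exact: is_interval_measurable idom_interval. Qed.

Definition slope : R -> R := rslope V \_ I.

Lemma slopeE x : I x -> slope x = rslope V x.
Proof. by move=> dx; rewrite /slope patchT// inE. Qed.

Lemma slope_out x : ~ I x -> slope x = 0.
Proof. by move=> dx; rewrite /slope patchC// inE. Qed.

(** On the interval [I] the slope is monotone, so its superlevel sets there are
    intervals. *)
Lemma measurable_slope : measurable_fun [set: R] slope.
Proof.
apply/(measurable_restrictT _ measurable_idom).
move=> mI; apply: (measurability _ (RGenCInfty.measurableE R)) => // _ [_ [r ->] <-].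
apply: is_interval_measurable => s t [ds] /=.
rewrite in_itv/= andbT => rs [dt] _ u /andP[su ut].
have du : I u by exact: idom_itv ds dt su ut.
by split => //=; rewrite in_itv/= andbT (le_trans rs)// rslope_nd.
Qed.

Lemma countable_subset1 (A : set R) : is_subset1 A -> countable A.
Proof.
move=> A1; have [->//|/set0P[x Ax]] := eqVneq A set0.
apply: (@sub_countable _ _ _ [set x]) => //.
by apply: subset_card_le => y Ay; exact: A1.
Qed.

Lemma countable_setU (A B : set R) :
  countable A -> countable B -> countable (A `|` B).
Proof.
move=> cA cB; rewrite (_ : A `|` B = \bigcup_b (if b then A else B)).
  by apply: bigcup_countable => // -[].
apply/seteqP; split => x; first by case=> ?; [exists true|exists false].
by case=> -[] _ ?; [left|right].
Qed.

(** The points where the slope jumps over the interval from p to q.  Two such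
    points would have a point between them with slope both at most p and at
    least q, so there is at most one; as p and q are rational, there are
    countably many jumps in all. *)
Definition slope_gap (pq : rat * rat) : set R := [set x | [/\ I x, pq.1 < pq.2,
  forall u, I u -> u < x -> rslope V u <= ratr pq.1 &
  forall w, I w -> x < w -> ratr pq.2 <= rslope V w]].

Definition slope_jumps : set R := \bigcup_pq slope_gap pq.

Lemma countable_slope_jumps : countable slope_jumps.
Proof.
apply: bigcup_countable => // -[p q] _; apply: countable_subset1.
have H (x y : R) : slope_gap (p, q) x -> slope_gap (p, q) y -> x < y -> False.
  move=> [dx /= pq _ hx] [dy _ hy _] xy.
  have dm : I ((x + y) / 2) by apply: (idom_itv dx dy); lra.
  have h1 := hx _ dm ltac:(lra); have h2 := hy _ dm ltac:(lra).
  have := le_trans h1 h2; rewrite ler_rat leNgt pq//.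
by move=> x y hx hy; apply/eqP; rewrite eq_le !leNgt; apply/andP; split;
  apply/negP => xy; [exact: H hy hx xy|exact: H hx hy xy].
Qed.

Lemma derive1_eps (f : R -> R) (x l : R) :
  (forall e, 0 < e -> exists2 d, 0 < d & forall h, h != 0 -> `|h| < d ->
     `|f (h + x) - f x - l * h| <= e * `|h|) -> derive1 f x = l.
Proof.
move=> H; rewrite /derive1; apply/cvg_lim; first exact: Rhausdorff.
apply/cvgrPdist_le => e e0; have [d d0 hd] := H e e0.
near=> h.
have h0 : h != 0 by near: h; exact: nbhs_dnbhs_neq.
have hn : `|h| < d by near: h; exact: dnbhs0_lt.
have := hd h h0 hn; rewrite -ler_pdivrMr ?normr_gt0// -normf_div.
rewrite distrC (_ : (f (h + x) - f x - l * h) / h = h^-1 *: (f (h + x) - f x) - l)//.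
by rewrite /GRing.scale/=; field.
Unshelve. all: by end_near. Qed.

(** If the slopes on both sides of x stayed e apart, the supremum of those on
    the left and that supremum plus e would enclose two rationals. *)
Lemma slope_no_jump x : I x -> ~ slope_jumps x -> forall e, 0 < e ->
  exists u w, [/\ I u, I w, u < x < w & rslope V w <= rslope V u + e].
Proof.
move=> dx nj e e0; apply: contrapT => /forallNP H; apply: nj.
pose S := [set rslope V u | u in [set u | I u /\ u < x]].
have [u0 du0 u0x] := idom_left cV dx.
have S0 : S !=set0 by exists (rslope V u0); exists u0.
have Sub : has_ubound S.
  by exists (rslope V x) => _ [u [du ux] <-]; rewrite rslope_nd// ltW.
have [p] := rat_in_itvoo (ltac:(lra) : sup S < sup S + e / 2).
rewrite in_itv/= => /andP[p1 p2].
have [q] := rat_in_itvoo (ltac:(lra) : sup S + e / 2 < sup S + e).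
rewrite in_itv/= => /andP[q1 q2].
exists (p, q) => //; split => //=.
- by rewrite -(ltr_rat R); lra.
- move=> u du ux; apply: le_trans (ltW p1); apply: ub_le_sup => //; by exists u.
- move=> w dw xw; apply: (le_trans (ltW q2)).
  rewrite -lerBrDr; apply: ge_sup => // _ [u [du ux] <-].
  rewrite lerBrDr leNgt; apply/negP => wu; apply: (H u); exists w.
  by split => //; [rewrite ux|exact: ltW].
Qed.

(** Difference quotients at x lie between slopes at nearby points on either
    side of x, and these are close to each other when x is not a jump. *)
Lemma derive1_potential x : I x -> ~ slope_jumps x ->
  derive1 (fine \o V) x = slope x.
Proof.
move=> dx nj; rewrite slopeE//; apply: derive1_eps => e e0.
have [u [w [du dw /andP[ux xw] uw]]] := slope_no_jump dx nj e0.
exists (Num.min (x - u) (w - x)); first by rewrite lt_min !subr_gt0 ux.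
move=> h h0; rewrite lt_min => /andP[hu hw] /=.
rewrite -!/(rpot V _).
have rux : rslope V u <= rslope V x by rewrite rslope_nd// ltW.
have rxw : rslope V x <= rslope V w by rewrite rslope_nd// ltW.
move: h0; rewrite neq_lt => /orP[hlt|hgt].
  move: hu hw; rewrite ltr0_norm// => hu hw.
  have dh : I (h + x) by apply: (idom_itv du dx); lra.
  have /andP[] := rslope_bounds cV dh dx ltac:(lra).
  have : rslope V u <= rslope V (h + x) by rewrite rslope_nd//; lra.
  move=> r1 b1 b2; rewrite ler_norml; apply/andP; split; nra.
move: hu hw; rewrite gtr0_norm// => hu hw.
have dh : I (h + x) by apply: (idom_itv dx dw); lra.
have /andP[] := rslope_bounds cV dx dh ltac:(lra).
have : rslope V (h + x) <= rslope V w by rewrite rslope_nd//; lra.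
move=> r1 b1 b2; rewrite ler_norml; apply/andP; split; nra.
Qed.

(** The endpoints of the domain are captured by approximation instead of an
    infimum, so that an unbounded domain needs no separate treatment. *)
Definition idom_inf : set R :=
  [set x | ~ I x /\ (exists2 m, I m & x < m) /\
           forall w, x < w -> exists2 z, I z & z < w].
Definition idom_sup : set R :=
  [set x | ~ I x /\ (exists2 m, I m & m < x) /\
           forall w, w < x -> exists2 z, I z & w < z].

Lemma countable_idom_inf : countable idom_inf.
Proof.
apply: countable_subset1.
have H (x y : R) : idom_inf x -> idom_inf y -> x < y -> False.
  move=> [_ [_ hx]] [ny [[m dm ym] _]] xy; have [z dz zy] := hx _ xy; apply: ny.
  by apply: (idom_itv dz dm); exact: ltW.
by move=> x y hx hy; apply/eqP; rewrite eq_le !leNgt; apply/andP; split;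
  apply/negP => xy; [exact: H hy hx xy|exact: H hx hy xy].
Qed.

Lemma countable_idom_sup : countable idom_sup.
Proof.
apply: countable_subset1.
have H (x y : R) : idom_sup x -> idom_sup y -> x < y -> False.
  move=> [nx [[m dm mx] _]] [_ [_ hy]] xy; have [z dz xz] := hy _ xy; apply: nx.
  by apply: (idom_itv dm dz); exact: ltW.
by move=> x y hx hy; apply/eqP; rewrite eq_le !leNgt; apply/andP; split;
  apply/negP => xy; [exact: H hy hx xy|exact: H hx hy xy].
Qed.

(** Outside the closure of the domain V is infinite on a neighbourhood; this
    leaves only the endpoints, where neither V nor its derivative is
    controlled. *)
Lemma out_idom x : I !=set0 -> ~ I x ->
  [\/ idom_inf x, idom_sup x |
     exists u w, u < x < w /\ forall y, u < y < w -> V y = +oo%E].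
Proof.
move=> [m dm] nx.
have [xm|mx|xm] := ltgtP x m; last by move: nx; rewrite xm.
- have [|] := pselect (forall w, x < w -> exists2 z, I z & z < w).
    by move=> ?; apply: Or31; do 2 split => //; exists m.
  move/existsNP => [w] /not_implyP[xw /forall2NP nz]; apply: Or33.
  exists (x - 1), w; split; first by rewrite xw; lra.
  move=> y /andP[_ yw]; apply/eqP; rewrite -leye_eq leNgt; apply/negP => Vy.
  have wm : w <= m by rewrite leNgt; apply/negP => mw; have [] := nz m.
  have [] := nz ((y + w) / 2); last by apply; lra.
  case: dm => _ [b [_ mb _ Vb]]; apply.
  by exists y, b; split => //; lra.
- have [|] := pselect (forall w, w < x -> exists2 z, I z & w < z).
    by move=> ?; apply: Or32; do 2 split => //; exists m.
  move/existsNP => [w] /not_implyP[wx /forall2NP nz]; apply: Or33.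
  exists w, (x + 1); split; first by rewrite wx; lra.
  move=> y /andP[wy _]; apply/eqP; rewrite -leye_eq leNgt; apply/negP => Vy.
  have mw : m <= w by rewrite leNgt; apply/negP => wm; have [] := nz m.
  have [] := nz ((w + y) / 2); last by apply; lra.
  case: dm => a [_ [am _ Va _]]; apply.
  by exists a, y; split => //; lra.
Qed.

(** The exceptional points are the jumps and the endpoints; at the other points
    outside the domain, [fine] of the infinite value is locally 0, as is the
    slope. *)
Lemma countable_slope_neq : I !=set0 ->
  countable [set x | derive1 (fine \o V) x <> slope x].
Proof.
move=> I0; apply: (@sub_countable _ _ _ (slope_jumps `|` (idom_inf `|` idom_sup))).
  apply: subset_card_le => x /= ne.
  have [dx|ndx] := pselect (I x).
    by left; apply: contrapT => nj; apply: ne; exact: derive1_potential.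
  have [?|?|[u [w [/andP[ux xw] Voo]]]] := out_idom I0 ndx; [by right; left|by right; right|].
  exfalso; apply: ne; rewrite slope_out//; apply: derive1_eps => e e0.
  exists (Num.min (x - u) (w - x)); first by rewrite lt_min !subr_gt0 ux.
  move=> h _; rewrite lt_min => /andP[]; rewrite !ltr_norml => /andP[? ?] /andP[? ?].
  rewrite /= !Voo; [|lra..].
  by rewrite /= subr0 mul0r subrr normr0 mulr_ge0// ltW.
apply: countable_setU; first exact: countable_slope_jumps.
by apply: countable_setU; [exact: countable_idom_inf|exact: countable_idom_sup].
Qed.

Lemma measurable_countable (A : set R) : countable A -> measurable A.
Proof. by apply: countable_measurable => t; exact: measurable_set1. Qed.

(** A modification on a countable set preserves Borel measurability, whereas a
    modification on a null set would not. *)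
Lemma measurable_fun_countable_neq (f h : R -> R) :
  measurable_fun [set: R] h ->
  countable [set x | f x <> h x] ->
  measurable_fun [set: R] f.
Proof.
move=> mh cN _ A mA; rewrite setTI.
set N := [set x | _] in cN.
rewrite (_ : f @^-1` A = (f @^-1` A `&` N) `|` (h @^-1` A `\` N)).
  apply: measurableU.
    by apply: measurable_countable; apply: sub_countable cN; exact: subset_card_le.
  apply: measurableD; last exact: measurable_countable.
  by rewrite -[X in measurable X]setTI; exact: mh.
apply/seteqP; split => x /=.
  move=> fA; have [|/contrapT fh] := pselect (f x <> h x); first by left.
  by right; split; [rewrite -fh|move/(_ fh)].
by case=> [[]//|[hA /contrapT ->]].
Qed.

End Slope.

(** * The fundamental theorem of calculus for a log-concave density *)

(** Cutting [y, x] into n equal pieces makes the increments of M telescope, so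
    the total increment of h is at most (M x - M y) (x - y) / n for all n.  This
    replaces the integration of a derivative that exists only almost
    everywhere. *)
Lemma eq_of_small_increments {R : realType} (h M : R -> R) (y x : R) : y <= x ->
  (forall u v, y <= u -> u < v -> v <= x ->
     `|h v - h u| <= (M v - M u) * (v - u)) -> h x = h y.
Proof.
move=> yx H; apply/eqP; rewrite -subr_eq0 -normr_eq0 eq_le normr_ge0 andbT.
have [->|nyx] := eqVneq y x; first by rewrite subrr normr0.
have {}yx : y < x by rewrite lt_neqAle nyx.
have key n : `|h x - h y| <= (M x - M y) * (x - y) / n.+1%:R.
  pose p k : R := y + (x - y) * k%:R / n.+1%:R.
  have p0 : p 0%N = y by rewrite /p mulr0 mul0r addr0.
  have pn : p n.+1 = x by rewrite /p mulfK ?pnatr_eq0//; lra.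
  have dp k : p k.+1 - p k = (x - y) / n.+1%:R.
    by rewrite /p -natr1; field; rewrite nat1r pnatr_eq0.
  have dpos : 0 < (x - y) / n.+1%:R by rewrite divr_gt0 ?subr_gt0.
  have yp k : y <= p k.
    by rewrite /p lerDl mulr_ge0 ?invr_ge0 ?ler0n// mulr_ge0 ?ler0n// subr_ge0 ltW.
  have px k : (k <= n.+1)%N -> p k <= x.
    move=> kn; rewrite -[X in _ <= X]pn /p lerD2l ler_wpM2r ?invr_ge0 ?ler0n//.
    by rewrite ler_wpM2l ?ler_nat// subr_ge0 ltW.
  have step k : (k < n.+1)%N ->
      `|h (p k.+1) - h (p k)| <= (M (p k.+1) - M (p k)) * ((x - y) / n.+1%:R).
    move=> kn; rewrite -(dp k); apply: H => //; last exact: px.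
    by rewrite -subr_gt0 dp.
  have -> : h x - h y = \sum_(0 <= k < n.+1) (h (p k.+1) - h (p k)).
    by rewrite (telescope_sumr (h \o p))//= pn p0.
  apply: (le_trans (ler_norm_sum _ _ _)).
  apply: (le_trans (ler_sum_nat (fun k kn => step k (proj2 (andP kn))))).
  rewrite -mulr_suml (telescope_sumr (M \o p))//= pn p0 mulrA lexx//.
apply/ler_addgt0Pr => e e0; rewrite add0r.
set c := (M x - M y) * (x - y) in key.
have [n ne] : exists n, `|c| / e < n.+1%:R.
  exists (Num.truncn (`|c| / e)); exact: truncnS_gt.
apply: (le_trans (key n)); rewrite ler_pdivrMr// (le_trans (ler_norm _))//.
by rewrite mulrC -ler_pdivrMr// ltW.
Qed.

Lemma ler_dist_expRN {R : realType} (a b M : R) : expR (- a) <= M ->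
  expR (- b) <= M -> `|expR (- a) - expR (- b)| <= M * `|a - b|.
Proof.
wlog ab : a b / a <= b => [H|] aM bM.
  have [/H|/ltW /H] := leP a b; first exact.
  by rewrite distrC (distrC b); exact.
rewrite ger0_norm ?subr_ge0 ?ler_expR ?lerN2// ler0_norm ?subr_le0//.
have -> : expR (- b) = expR (- a) * expR (a - b) by rewrite -expRD; congr expR; lra.
have := expR_ge1Dx (a - b); have := expR_gt0 (- a); nra.
Qed.

Lemma measurable_expeR {R : realType} : measurable_fun [set: \bar R] (@expeR R).
Proof.
apply: (measurability _ (ErealGenCInfty.measurableE R)) => // _ [_ [r ->] <-].
rewrite setTI; have [r0|r0] := leP r 0.
  rewrite (_ : _ @^-1` _ = setT)//; apply/seteqP; split => // x _ /=.
  by rewrite in_itv/= andbT (le_trans _ (expeR_ge0 x))// lee_fin.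
rewrite (_ : _ @^-1` _ = `[(ln r)%:E, +oo[%classic); first exact: emeasurable_itv.
have rE x : (r%:E <= expeR x)%E = ((ln r)%:E <= x)%E.
  by rewrite -[RHS]lee_expeR /= lnK.
by apply/seteqP; split => x /=; rewrite !in_itv/= !andbT rE.
Qed.

Section Derivative.
Context {R : realType}.
Variables (eta : probability (measurableTypeR R) R) (V : R -> \bar R).
Hypothesis hV : is_potential eta V.

Local Notation I := (idom V).
Local Notation mu := (@lebesgue_measure R).

Let cV : convex_lsc V := proj1 hV.

Definition dens (x : R) : R := expR (- rpot V x).

Lemma dens_gt0 x : 0 < dens x. Proof. exact: expR_gt0. Qed.

Lemma expeR_dens x : (V x < +oo)%E -> expeR (- V x) = (dens x)%:E.
Proof. by move=> Vx; rewrite (potential_fin cV Vx). Qed.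

Lemma measurable_potential : measurable_fun [set: R] V.
Proof. by case: cV => _ _ /lower_semicontinuous_measurable. Qed.

Lemma measurable_expeR_potential :
  measurable_fun [set: R] (fun x => expeR (- V x)).
Proof.
apply: (measurableT_comp measurable_expeR).
by apply: measurableT_comp => //; exact: measurable_potential.
Qed.

Lemma potential_itv_mass (u v l c : R) : u <= v -> 0 <= l ->
  (forall z, u < z -> z <= v -> (l%:E <= expeR (- V z) <= c%:E)%E) ->
  l * (v - u) <= fine (eta `]u, v]%classic) <= c * (v - u).
Proof.
move=> uv l0 H; have [|nuv] := eqVneq u v.
  by move=> ->; rewrite set_itvoc0 measure0 subrr !mulr0 lexx.
have {}uv : u < v by rewrite lt_neqAle nuv.
have c0 : 0 <= c.
  by have /andP[h1 h2] := H v uv (lexx _); rewrite -lee_fin (le_trans _ (le_trans h1 h2))// lee_fin.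
rewrite -!lee_fin fineK ?fin_num_measure// (proj2 hV)//.
have mf : measurable_fun `]u, v] (fun x => expeR (- V x)).
  apply: measurable_funTS; exact: measurable_expeR_potential.
apply/andP; split.
  have -> : (l * (v - u))%:E = (\int[mu]_(x in `]u, v]) cst l%:E x)%E.
    by rewrite integral_cst//= lebesgue_measure_itv/= lte_fin uv -EFinB.
  apply: ge0_le_integral => //.
  by move=> x /=; rewrite in_itv/= => /andP[ux xv]; have /andP[] := H _ ux xv.
have -> : (c * (v - u))%:E = (\int[mu]_(x in `]u, v]) cst c%:E x)%E.
  by rewrite integral_cst//= lebesgue_measure_itv/= lte_fin uv -EFinB.
apply: ge0_le_integral => //; first by move=> x _; exact: expeR_ge0.
by move=> x /=; rewrite in_itv/= => /andP[ux xv]; have /andP[] := H _ ux xv.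
Qed.

Lemma bounded_eta_integrable (A : set R) (f : R -> R) (C : R) : measurable A ->
  measurable_fun [set: R] f -> (forall z, A z -> `|f z| <= C) ->
  eta.-integrable A (EFin \o f).
Proof.
move=> mA mf fC; apply: (@le_integrable _ _ _ _ _ _ _ (EFin \o cst C)) => //.
- by apply/measurable_EFinP; exact: measurable_funTS.
- move=> z Az /=; rewrite lee_fin (le_trans (fC z Az))// ler_norm//.
- exact: finite_measure_integrable_cst.
Qed.

Lemma slope_itv_integrable y x : I y -> I x ->
  eta.-integrable `]y, x] (EFin \o slope V).
Proof.
move=> dy dx; apply: (@bounded_eta_integrable _ _ (`|rslope V y| + `|rslope V x|)) => //.
  exact: measurable_slope.
move=> z; rewrite /= in_itv/= => /andP[yz zx].
have dz : I z by apply: (idom_itv dy dx) => //; exact: ltW.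
rewrite slopeE//.
have := rslope_nd cV dy dz (ltW yz); have := rslope_nd cV dz dx zx.
move=> h1 h2; have := ler_norm (rslope V x); have := ler_norm (- rslope V y).
rewrite normrN => h3 h4; rewrite ler_norml; apply/andP; split.
- have := normr_ge0 (rslope V x); lra.
- have := normr_ge0 (rslope V y); lra.
Qed.

Lemma Rintegral_eta_split (f : R -> R) y u v : y <= u -> u <= v ->
  eta.-integrable `]y, v] (EFin \o f) ->
  \int[eta]_(z in `]y, v]) f z =
  \int[eta]_(z in `]y, u]) f z + \int[eta]_(z in `]u, v]) f z.
Proof.
move=> yu uv intf.
have E : `]y, v]%classic = `]y, u] `|` `]u, v].
  by rewrite -itv_bndbnd_setU// bnd_simp.
rewrite E Rintegral_setU//; first by rewrite -E.
apply/disj_setPS => z [/=]; rewrite 2!in_itv/= => /andP[_ zu] /andP[].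
by rewrite ltNge zu.
Qed.

(** The derivative of exp (- V) is - V' exp (- V).  Between u and v, the
    increment of exp (- V) and the integral of the slope against eta cancel up
    to a multiple of the oscillation of the slope times v - u, as the density is
    Lipschitz on compact parts of the domain; [eq_of_small_increments] then
    concludes. *)
Lemma Rintegral_slope y x : I y -> I x -> y <= x ->
  \int[eta]_(z in `]y, x]) slope V z = dens y - dens x.
Proof.
move=> dy dx yx.
pose C := `|rslope V y| + `|rslope V x|.
pose G := expR (- rpot V y + C * (x - y)).
have C0 : 0 <= C by rewrite addr_ge0.
have G0 : 0 < G by exact: expR_gt0.
pose h v := dens v + \int[eta]_(z in `]y, v]) slope V z.
have dI z : y <= z -> z <= x -> I z by exact: idom_itv.
have RC z : y <= z -> z <= x -> `|rslope V z| <= C.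
  move=> yz zx; have dz := dI _ yz zx.
  have := rslope_nd cV dy dz yz; have := rslope_nd cV dz dx zx.
  move=> h1 h2; have := ler_norm (rslope V x); have := ler_norm (- rslope V y).
  rewrite normrN => h3 h4; rewrite ler_norml; apply/andP; split; rewrite /C.
  - have := normr_ge0 (rslope V x); lra.
  - have := normr_ge0 (rslope V y); lra.
have WC u v : y <= u -> u <= v -> v <= x -> `|rpot V v - rpot V u| <= C * (v - u).
  move=> yu; have [->|nuv] := eqVneq u v; first by rewrite !subrr normr0 mulr0.
  rewrite le_eqVlt (negPf nuv)/= => uv vx.
  have du := dI _ yu (le_trans (ltW uv) vx); have dv := dI _ (le_trans yu (ltW uv)) vx.
  have /andP[] := rslope_bounds cV du dv uv.
  have := RC _ yu (le_trans (ltW uv) vx); have := RC _ (le_trans yu (ltW uv)) vx.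
  rewrite !ler_norml => /andP[? ?] /andP[? ?] ? ?; apply/andP; split; nra.
have gG z : y <= z -> z <= x -> dens z <= G.
  move=> yz zx; rewrite /dens /G ler_expR.
  have := WC _ _ (lexx y) yz zx; rewrite ler_norml => /andP[h1 _].
  have : C * (z - y) <= C * (x - y) by rewrite ler_wpM2l// lerD2r.
  lra.
have gC u v : y <= u -> u <= v -> v <= x -> `|dens v - dens u| <= G * C * (v - u).
  move=> yu uv vx; apply: (le_trans (@ler_dist_expRN _ _ _ G _ _)).
  - by apply: gG => //; lra.
  - by apply: gG => //; lra.
  - by rewrite -mulrA ler_wpM2l// ?WC// ltW.
suff hxy : h x = h y by move: hxy; rewrite /h set_itvoc0 Rintegral_set0 addr0; lra.
apply: (@eq_of_small_increments _ h (fun z => G * rslope V z + G * C ^+ 2 * z)) => //.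
move=> u v yu uv vx; have d0 : 0 < v - u by lra.
have du : I u by apply: dI; lra.
have dv : I v by apply: dI; lra.
rewrite /h (Rintegral_eta_split yu (ltW uv) (slope_itv_integrable dy dv)).
set J := \int[eta]_(z in `]u, v]) slope V z.
set K := \int[eta]_(z in _) _.
pose m := fine (eta `]u, v]%classic).
have GC0 : 0 <= G * C by rewrite mulr_ge0// ltW.
have gnear z w : u <= z -> z <= v -> u <= w -> w <= v ->
    `|dens z - dens w| <= G * C * (v - u).
  move=> uz zv uw wv; have [zw|/ltW wz] := leP z w.
    rewrite distrC; apply: (le_trans (gC z w _ _ _)); try lra.
    by rewrite ler_wpM2l//; lra.
  apply: (le_trans (gC w z _ _ _)); try lra.
  by rewrite ler_wpM2l//; lra.
have mbound w : u <= w -> w <= v -> `|m - dens w * (v - u)| <= G * C * (v - u) * (v - u).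
  move=> uw wv.
  have /andP[m1 m2] : Num.max 0 (dens w - G * C * (v - u)) * (v - u) <= m <=
     (dens w + G * C * (v - u)) * (v - u).
    apply: potential_itv_mass; [exact: ltW|by rewrite le_max lexx|].
    move=> z uz zv; rewrite expeR_dens; last by apply: (idom_fin cV); apply: dI; lra.
    rewrite !lee_fin ge_max ltW ?dens_gt0//=.
    have := gnear z w (ltW uz) zv uw wv.
    rewrite ler_norml => /andP[? ?]; apply/andP; split; lra.
  have : (dens w - G * C * (v - u)) * (v - u) <= m.
    by apply: le_trans m1; rewrite ler_wpM2r ?le_max ?lexx ?orbT// ltW.
  rewrite ler_norml => ?; apply/andP; split; nra.
have mG : 0 <= m <= G * (v - u).
  have /andP[_ ->] : 0 * (v - u) <= m <= G * (v - u).
    apply: potential_itv_mass => //; first exact: ltW.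
    move=> z uz zv; rewrite expeR_dens; last by apply: (idom_fin cV); apply: dI; lra.
    by rewrite !lee_fin ltW ?dens_gt0//= gG//; lra.
  by rewrite andbT fine_ge0.
have intc c : eta.-integrable `]u, v] (EFin \o cst c) by exact: finite_measure_integrable_cst.
have /andP[J1 J2] : rslope V u * m <= J <= rslope V v * m.
  have ints := slope_itv_integrable du dv.
  rewrite /m -!Rintegral_cst//; apply/andP; split; apply: le_Rintegral => //;
    try exact: intc; move=> z; rewrite /= in_itv/= => /andP[uz zv].
    by rewrite slopeE ?rslope_nd ?ltW//; apply: dI; lra.
  by rewrite slopeE ?rslope_nd//; apply: dI; lra.
have /andP[b1 b2] := rslope_bounds cV du dv uv.
have e1 : dens v - dens u <= - rslope V u * dens v * (v - u).
  have -> : dens u = dens v * expR (rpot V v - rpot V u).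
    by rewrite /dens -expRD; congr expR; lra.
  have := expR_ge1Dx (rpot V v - rpot V u); have := dens_gt0 v; nra.
have e2 : - rslope V v * dens u * (v - u) <= dens v - dens u.
  have -> : dens v = dens u * expR (rpot V u - rpot V v).
    by rewrite /dens -expRD; congr expR; lra.
  have := expR_ge1Dx (rpot V u - rpot V v); have := dens_gt0 u; nra.
have Ruv : rslope V u <= rslope V v by apply: rslope_nd => //; exact: ltW.
have mu_u := mbound u (lexx _) (ltW uv); have mu_v := mbound v (ltW uv) (lexx _).
have RuC : `|rslope V u| <= C by apply: RC; lra.
have RvC : `|rslope V v| <= C by apply: RC; lra.
have pu : `|rslope V v * (m - dens u * (v - u))| <= C * (G * C * (v - u) * (v - u)).
  by rewrite normrM ler_pM.
have pv : `|rslope V u * (m - dens v * (v - u))| <= C * (G * C * (v - u) * (v - u)).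
  by rewrite normrM ler_pM.
have pm : (rslope V v - rslope V u) * m <= (rslope V v - rslope V u) * (G * (v - u)).
  by rewrite ler_wpM2l ?subr_ge0//; case/andP: mG.
have -> : dens v + (K + J) - (dens u + K) = (dens v - dens u) + J by ring.
move: pu pv; rewrite !ler_norml => /andP[pu1 pu2] /andP[pv1 pv2].
apply/andP; split; lra.
Qed.

End Derivative.

(** * Behaviour at the boundary of the domain *)

Section Exhaustion.
Context {R : realType}.

(** The running maxima of the rationals of J, in some enumeration, form the
    sequence; this treats bounded and unbounded intervals alike. *)
Lemma interval_exhaustion (J : set R) (m : R) : is_interval J ->
  (forall x, J x -> exists2 w, J w & x < w) -> J m ->
  exists z : nat -> R, [/\ nondecreasing_seq z, forall n, J (z n) /\ m <= z n &
    forall x, J x -> exists n, x <= z n].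
Proof.
move=> iJ oJ Jm.
pose e k : R := if (unpickle k : option rat) is Some q then
  if ratr q \in J then ratr q else m else m.
have Je k : J (e k).
  by rewrite /e; case: unpickle => // q; case: ifPn => // /set_mem.
pose z := fix z n := if n is k.+1 then Num.max (z k) (e k) else m.
exists z; split.
- by apply/nondecreasing_seqP => n /=; rewrite le_max lexx.
- elim=> [|n [Jn mn]] /=; first by split.
  by rewrite le_max mn; split => //; rewrite /Num.max; case: ifP.
- move=> x Jx; have [w Jw xw] := oJ x Jx.
  have [q] := rat_in_itvoo xw; rewrite in_itv/= => /andP[xq qw].
  have Jq : J (ratr q) by apply: (iJ _ _ Jx Jw); rewrite !ltW.
  exists (pickle q).+1; rewrite /= le_max; apply/orP; right.
  by rewrite /e pickleK mem_set// ltW.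
Qed.

End Exhaustion.

Section Boundary.
Context {R : realType}.
Variables (eta : probability (measurableTypeR R) R) (V : R -> \bar R).
Hypothesis hV : is_potential eta V.
Hypothesis ec : essentially_continuous eta V.

Local Notation I := (idom V).
Local Notation mu := (@lebesgue_measure R).

Let cV : convex_lsc V := proj1 hV.

Lemma eta_dominated (A : set R) : measurable A -> mu A = 0%E -> eta A = 0%E.
Proof.
move=> mA A0; rewrite (proj2 hV)//; apply: null_set_integral => //.
by apply: measurable_funTS; exact: measurable_expeR_potential hV.
Qed.

Lemma eta_countable (A : set R) : countable A -> eta A = 0%E.
Proof.
move=> cA; apply: eta_dominated; first exact: measurable_countable.
exact: countable_lebesgue_measure0.
Qed.

Lemma eta_infinite (A : set R) : measurable A ->
  (forall x, A x -> V x = +oo%E) -> eta A = 0%E.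
Proof.
move=> mA Aoo; rewrite (proj2 hV)// integral0_eq// => x Ax.
by rewrite Aoo.
Qed.

(** Otherwise V would be finite at one point at most, and eta would be null. *)
Lemma idom_nonempty : I !=set0.
Proof.
apply: contrapT => nI.
have cD : countable [set x | (V x < +oo)%E].
  apply: countable_subset1.
  have H (x y : R) : (V x < +oo)%E -> (V y < +oo)%E -> x < y -> False.
    by move=> Vx Vy xy; apply: nI; exists ((x + y) / 2); exact: idom_mid.
  by move=> x y hx hy; apply/eqP; rewrite eq_le !leNgt; apply/andP; split;
    apply/negP => xy; [exact: H hy hx xy|exact: H hx hy xy].
have mD : measurable [set x | (V x < +oo)%E] by exact: measurable_countable.
have : eta setT = 0%E.
  rewrite -(setUv [set x | (V x < +oo)%E]); apply: null_set_setU => //.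
  - exact: measurableC.
  - exact: eta_countable.
  - apply: eta_infinite; first exact: measurableC.
    by move=> x /= /negP; rewrite -leNgt leye_eq => /eqP.
by rewrite probability_setT => /eqP; rewrite onee_eq0.
Qed.

Lemma eta_out_idom : eta (~` I) = 0%E.
Proof.
have mI := measurable_idom V.
set N := idom_inf V `|` idom_sup V.
have cN : countable N.
  by apply: countable_setU; [exact: countable_idom_inf|exact: countable_idom_sup].
have mN : measurable N by exact: measurable_countable.
apply/eqP; rewrite eq_le measure_ge0 andbT.
apply: (@le_trans _ _ (eta (N `|` (~` I `\` N)))).
  apply: le_measure; rewrite ?inE.
  - exact: measurableC.
  - by apply: measurableU => //; apply: measurableD => //; exact: measurableC.
  - by move=> x nx; have [?|?] := pselect (N x); [left|right].
rewrite null_set_setU//.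
- by apply: measurableD => //; exact: measurableC.
- exact: eta_countable.
apply: eta_infinite; first by apply: measurableD => //; exact: measurableC.
move=> x [nx nN]; have [h|h|[u [w [uxw Voo]]]] := out_idom idom_nonempty nx.
- by exfalso; apply: nN; left.
- by exfalso; apply: nN; right.
- exact: Voo.
Qed.

(** Near a point of the domain the density is bounded away from 0. *)
Lemma idom_in_support : I `<=` msupport eta.
Proof.
move=> x dx U oU Ux.
have [u0 du0 u0x] := idom_left cV dx; have [w0 dw0 xw0] := idom_right cV dx.
have [d /= d0 dU] : nbhs x U by exact: open_nbhs_nbhs.
pose u := Num.max u0 (x - d / 2).
have ux : u < x by rewrite /u gt_max u0x; lra.
have u0u : u0 <= u by rewrite /u le_max lexx.
have du : x - d / 2 <= u by rewrite /u le_max lexx orbT.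
have Iz z : u0 <= z -> z <= x -> I z by exact: idom_itv.
have Iu : I u by apply: Iz => //; exact: ltW.
have UU : `]u, x]%classic `<=` U.
  move=> z; rewrite /= in_itv/= => /andP[uz zx]; apply: dU.
  by rewrite /ball/= ger0_norm; lra.
have mU : measurable U by exact: open_measurable.
apply: (@lt_le_trans _ _ (eta `]u, x]%classic)); last first.
  by apply: le_measure => //; rewrite inE.
rewrite -(fineK (fin_num_measure eta _ _))// lte_fin.
pose l := Num.min (expR (- (rpot V x + `|rslope V u| * (x - u)))) 1.
have l0 : 0 < l by rewrite lt_min expR_gt0 ltr01.
apply: (@lt_le_trans _ _ (l * (x - u))); first by rewrite mulr_gt0// subr_gt0.
pose c := expR (- (rpot V x - `|rslope V x| * (x - u))).
suff /andP[] : l * (x - u) <= fine (eta `]u, x]%classic) <= c * (x - u) by [].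
apply: (potential_itv_mass hV); [exact: ltW|exact: ltW|move=> z uz zx].
have dz : I z by apply: Iz; lra.
rewrite (expeR_dens hV); last exact: idom_fin dz.
have h1 : rpot V z <= rpot V x + `|rslope V u| * (x - u).
  have [->|nzx] := eqVneq z x; first by rewrite lerDl mulr_ge0// subr_ge0 ltW.
  have zx' : z < x by rewrite lt_neqAle nzx.
  have /andP[b1 _] := rslope_bounds cV dz dx zx'.
  have b2 := rslope_nd cV Iu dz (ltW uz); have b3 := ler_norm (- rslope V u).
  rewrite normrN in b3.
  have p1 : - `|rslope V u| * (x - z) <= rslope V z * (x - z).
    by rewrite ler_wpM2r//; lra.
  have p2 : `|rslope V u| * (x - z) <= `|rslope V u| * (x - u).
    by rewrite ler_wpM2l//; lra.
  lra.
have h2 : rpot V x - `|rslope V x| * (x - u) <= rpot V z.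
  have [->|nzx] := eqVneq z x; first by rewrite lerBlDr lerDl mulr_ge0// subr_ge0 ltW.
  have zx' : z < x by rewrite lt_neqAle nzx.
  have /andP[_ b1] := rslope_bounds cV dz dx zx'.
  have p1 : rslope V x * (x - z) <= `|rslope V x| * (x - z).
    by rewrite ler_wpM2r ?ler_norm//; lra.
  have p2 : `|rslope V x| * (x - z) <= `|rslope V x| * (x - u).
    by rewrite ler_wpM2l//; lra.
  lra.
rewrite !lee_fin ge_min /dens /c !ler_expR; apply/andP; split.
  by apply/orP; left; lra.
by lra.
Qed.

(** An endpoint of the domain is on the boundary of the support, where
    essential continuity makes the density vanish. *)
Lemma potential_idom_inf x : idom_inf V x -> V x = +oo%E.
Proof.
move=> [nx [[m dm xm] hx]].
suff : expeR (- V x) = 0%E by move=> /eqP; rewrite expeR_eq0 eqe_oppLR => /eqP.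
apply: ec; split.
- move=> U [d /= d0 dU]; have [z dz zx] := hx (x + d) ltac:(lra).
  exists z; split; first exact: idom_in_support.
  have xz : x < z.
    by rewrite ltNge; apply/negP => zx'; apply: nx; apply: (idom_itv dz dm) => //; exact: ltW.
  by apply: dU; rewrite /ball/= ltr0_norm; lra.
- move=> -[d /= d0 dU].
  have : msupport eta (x - d / 2) by apply: dU; rewrite /ball/= gtr0_norm; lra.
  move=> /(_ `]-oo, x[%classic (lray_open x)) /=.
  rewrite in_itv/= eta_infinite//.
    by move=> /(_ ltac:(lra)); rewrite ltxx.
  move=> y /=; rewrite in_itv/= => yx.
  apply/eqP; rewrite -leye_eq leNgt; apply/negP => Vy; apply: nx.
  by case: dm => _ [b [_ mb _ Vb]]; exists y, b; split => //; exact: lt_trans mb.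
Qed.

Lemma potential_idom_sup x : idom_sup V x -> V x = +oo%E.
Proof.
move=> [nx [[m dm mx] hx]].
suff : expeR (- V x) = 0%E by move=> /eqP; rewrite expeR_eq0 eqe_oppLR => /eqP.
apply: ec; split.
- move=> U [d /= d0 dU]; have [z dz xz] := hx (x - d) ltac:(lra).
  exists z; split; first exact: idom_in_support.
  have zx : z < x.
    by rewrite ltNge; apply/negP => xz'; apply: nx; apply: (idom_itv dm dz) => //; exact: ltW.
  by apply: dU; rewrite /ball/= gtr0_norm; lra.
- move=> -[d /= d0 dU].
  have : msupport eta (x + d / 2) by apply: dU; rewrite /ball/= ltr0_norm; lra.
  move=> /(_ `]x, +oo[%classic (rray_open x)) /=.
  rewrite in_itv/= andbT eta_infinite//.
    by move=> /(_ ltac:(lra)); rewrite ltxx.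
  move=> y /=; rewrite in_itv/= andbT => xy.
  apply/eqP; rewrite -leye_eq leNgt; apply/negP => Vy; apply: nx.
  by case: dm => a [_ [am _ Va _]]; exists a, y; split => //; exact: lt_trans mx.
Qed.

(** At a finite endpoint V is infinite, hence large nearby by lower
    semicontinuity; if the domain is unbounded, a density bounded away from 0
    would have infinite mass. *)
Lemma dens_decay_left y0 e : I y0 -> 0 < e ->
  exists2 y, I y /\ y <= y0 & dens V y < e.
Proof.
move=> dy0 e0; apply: contrapT => /forall2NP H.
have He y : I y -> y <= y0 -> e <= dens V y.
  by move=> dy yy0; rewrite leNgt; apply/negP => ye; have [|] := H y; [apply; split|apply].
have [[a la]|nlb] := pselect (has_lbound I).
  have hI : has_inf I by split; [exists y0|exists a].
  have inf0 : idom_inf V (inf I).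
    have lb z : I z -> inf I <= z by move=> dz; apply: inf_lbound => //; exists a.
    have nI : ~ I (inf I).
      move=> dI; have [u du uI] := idom_left cV dI.
      by have := lb _ du; rewrite leNgt uI.
    split => //; split.
      exists y0 => //; rewrite lt_neqAle lb// andbT; apply/eqP => E.
      by apply: nI; rewrite E.
    move=> w Iw; have wI : 0 < w - inf I by rewrite subr_gt0.
    by have [z dz zw] := inf_adherent wI hI; exists z => //; lra.
  have Voo := potential_idom_inf inf0.
  have [_ _ lsc] := cV.
  have [U [d /= d0 dU] HU] := lsc (inf I) (- ln e) ltac:(by rewrite Voo ltry).
  have [nI [[m dm Im]]] := inf0.
  move=> /(_ (Num.min (inf I + d) y0)) [|z dz].
    rewrite lt_min ltrDl d0/= lt_neqAle; apply/andP; split; last exact: inf_lbound (ex_intro _ a la) _ dy0.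
    by apply/eqP => E; apply: nI; rewrite E.
  rewrite lt_min => /andP[zd zy0].
  have Iz : inf I < z.
    rewrite ltNge; apply/negP => zI; apply: nI.
    by apply: (idom_itv dz dm) => //; exact: ltW.
  have Uz : U z by apply: dU; rewrite /ball/= ltr0_norm; lra.
  have := HU z Uz; rewrite (potential_fin cV (idom_fin cV dz)) lte_fin.
  have := He z dz (ltW zy0); rewrite /dens -{1}[e]lnK ?posrE// ler_expR; lra.
pose n := 2 / e.
have n0 : 0 < n by rewrite divr_gt0.
have dI z : z <= y0 -> I z.
  move=> zy0; apply: contrapT => nz; apply: nlb; exists z => w dw.
  rewrite leNgt; apply/negP => wz; apply: nz.
  by apply: (idom_itv dw dy0) => //; exact: ltW.
pose c := expR (- (rpot V y0 - (`|rslope V y0|) * n)).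
have /andP[h _] : e * (y0 - (y0 - n)) <= fine (eta `](y0 - n), y0]%classic) <= c * (y0 - (y0 - n)).
  apply: (potential_itv_mass hV); [lra|exact: ltW|].
  move=> z nz zy0; rewrite (expeR_dens hV); last exact: (idom_fin cV (dI _ zy0)).
  rewrite !lee_fin He//=; last exact: dI.
  rewrite /c /dens ler_expR.
  have [->|nzx] := eqVneq z y0.
    by rewrite lerN2 lerBlDr lerDl mulr_ge0// ltW.
  have zx' : z < y0 by rewrite lt_neqAle nzx.
  have /andP[_ b1] := rslope_bounds cV (dI _ zy0) dy0 zx'.
  have p1 : rslope V y0 * (y0 - z) <= `|rslope V y0| * (y0 - z).
    by rewrite ler_wpM2r ?ler_norm//; lra.
  have p2 : `|rslope V y0| * (y0 - z) <= `|rslope V y0| * n.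
    by rewrite ler_wpM2l//; lra.
  lra.
have en : e * (y0 - (y0 - n)) = 2 by rewrite /n; field; rewrite gt_eqF.
have : fine (eta `](y0 - n), y0]%classic) <= 1.
  by rewrite -lee_fin fineK ?fin_num_measure//; exact: probability_le1.
lra.
Qed.

Lemma dens_decay_right y0 e : I y0 -> 0 < e ->
  exists2 y, I y /\ y0 <= y & dens V y < e.
Proof.
move=> dy0 e0; apply: contrapT => /forall2NP H.
have He y : I y -> y0 <= y -> e <= dens V y.
  by move=> dy yy0; rewrite leNgt; apply/negP => ye; have [|] := H y; [apply; split|apply].
have [[a la]|nlb] := pselect (has_ubound I).
  have hI : has_sup I by split; [exists y0|exists a].
  have ub z : I z -> z <= sup I by move=> dz; apply: ub_le_sup => //; exists a.
  have nI : ~ I (sup I).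
    move=> dI; have [u du uI] := idom_right cV dI.
    by have := ub _ du; rewrite leNgt uI.
  have sup0 : idom_sup V (sup I).
    split => //; split.
      exists y0 => //; rewrite lt_neqAle ub// andbT; apply/eqP => E.
      by apply: nI; rewrite -E.
    move=> w Iw; have wI : 0 < sup I - w by rewrite subr_gt0.
    by have [z dz zw] := sup_adherent wI hI; exists z => //; lra.
  have Voo := potential_idom_sup sup0.
  have [_ _ lsc] := cV.
  have [U [d /= d0 dU] HU] := lsc (sup I) (- ln e) ltac:(by rewrite Voo ltry).
  have [_ [[m dm Im]]] := sup0.
  move=> /(_ (Num.max (sup I - d) y0)) [|z dz].
    rewrite gt_max ltrBlDr ltrDl d0/= lt_neqAle ub// andbT.
    by apply/eqP => E; apply: nI; rewrite -E.
  rewrite gt_max => /andP[zd zy0].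
  have Iz : z < sup I.
    rewrite ltNge; apply/negP => zI; apply: nI.
    by apply: (idom_itv dm dz) => //; exact: ltW.
  have Uz : U z by apply: dU; rewrite /ball/= gtr0_norm; lra.
  have := HU z Uz; rewrite (potential_fin cV (idom_fin cV dz)) lte_fin.
  have := He z dz (ltW zy0); rewrite /dens -{1}[e]lnK ?posrE// ler_expR; lra.
pose n := 2 / e.
have n0 : 0 < n by rewrite divr_gt0.
have dI z : y0 <= z -> I z.
  move=> zy0; apply: contrapT => nz; apply: nlb; exists z => w dw.
  rewrite leNgt; apply/negP => wz; apply: nz.
  by apply: (idom_itv dy0 dw) => //; exact: ltW.
pose c := expR (- (rpot V y0 - (`|rslope V y0|) * n)).
have /andP[h _] : e * (y0 + n - y0) <= fine (eta `]y0, (y0 + n)]%classic) <= c * (y0 + n - y0).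
  apply: (potential_itv_mass hV); [lra|exact: ltW|].
  move=> z y0z zn; have dz := dI _ (ltW y0z).
  rewrite (expeR_dens hV); last exact: idom_fin dz.
  rewrite !lee_fin (He _ dz (ltW y0z))/= /c /dens ler_expR.
  have /andP[b1 _] := rslope_bounds cV dy0 dz y0z.
  have p1 : - `|rslope V y0| * (z - y0) <= rslope V y0 * (z - y0).
    rewrite ler_wpM2r//; first lra.
    by have := ler_norm (- rslope V y0); rewrite normrN; lra.
  have p2 : `|rslope V y0| * (z - y0) <= `|rslope V y0| * n.
    by rewrite ler_wpM2l//; lra.
  lra.
have en : e * (y0 + n - y0) = 2 by rewrite /n; field; rewrite gt_eqF.
have : fine (eta `]y0, (y0 + n)]%classic) <= 1.
  by rewrite -lee_fin fineK ?fin_num_measure//; exact: probability_le1.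
lra.
Qed.

End Boundary.

(** * Integrability of the slope *)

(** Monotone convergence along the exhaustion. *)
Lemma integrable_exhaustion d (T : measurableType d) (R : realType)
    (P : probability T R) (F : nat -> set T) (f : T -> R) (B : R) :
  (forall n, measurable (F n)) -> nondecreasing_seq F ->
  measurable_fun [set: T] f -> (forall n x, F n x -> 0 <= f x) ->
  (forall n, P.-integrable (F n) (EFin \o f)) ->
  (forall n, \int[P]_(x in F n) f x <= B) ->
  P.-integrable (\bigcup_n F n) (EFin \o f).
Proof.
move=> mF ndF mf f0 intF FB.
have mU : measurable (\bigcup_n F n) by exact: bigcup_measurable.
have mEf D : measurable_fun D (EFin \o f).
  by apply: measurable_funTS; exact/measurable_EFinP.
have f0U x : (\bigcup_n F n) x -> (0 <= (EFin \o f) x)%E.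
  by move=> [n _ Fx]; rewrite lee_fin; exact: f0 Fx.
apply/integrableP; split => //.
rewrite (eq_integral (EFin \o f)); last by move=> x /set_mem Ux; rewrite gee0_abs// f0U.
apply: (@le_lt_trans _ _ B%:E); last exact: ltry.
have cv := @ge0_nondecreasing_set_cvg_integral _ _ _ F (EFin \o f) P ndF mF (fun n => mEf _) (fun n x Fx => f0U x (ex_intro2 _ _ n I Fx)).
rewrite -(cvg_lim _ cv)//; apply: lime_le; first by apply/cvg_ex; eexists; exact: cv.
apply: nearW => n; rewrite -[leLHS]fineK ?lee_fin; first exact: FB.
exact: integrable_fin_num.
Qed.

Section SlopeIntegrals.
Context {R : realType}.
Variables (eta : probability (measurableTypeR R) R) (V : R -> \bar R).
Hypothesis hV : is_potential eta V.

Local Notation I := (idom V).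

Let cV : convex_lsc V := proj1 hV.

Let cst_integrable (A : set (measurableTypeR R)) (k : R) : measurable A ->
  eta.-integrable A (EFin \o cst k).
Proof. by move=> mA; exact: finite_measure_integrable_cst. Qed.

Let mass_le1 (A : set (measurableTypeR R)) : measurable A -> 0 <= fine (eta A) <= 1.
Proof.
move=> mA; rewrite fine_ge0//= -lee_fin fineK ?fin_num_measure//.
exact: probability_le1.
Qed.

(** On the right of m the slope minus its value c at m is nonnegative, and its
    integral up to any point of the domain is at most dens m + |c| by
    [Rintegral_slope]. *)
Lemma slope_integrable_right m : I m ->
  eta.-integrable (I `&` `]m, +oo[) (EFin \o slope V).
Proof.
move=> dm; pose c := rslope V m.
have [z [ndz zP zI]] := interval_exhaustion (@idom_interval _ V)
  (fun x dx => let: ex_intro2 w a b := idom_right cV dx in ex_intro2 _ _ w a b) dm.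
pose F n : set (measurableTypeR R) := `]m, z n]%classic.
have UF : \bigcup_n F n = I `&` `]m, +oo[.
  apply/seteqP; split => x /=.
    move=> [n _]; rewrite /F/= in_itv/= => /andP[mx xz].
    rewrite in_itv/= mx; split => //.
    by have [dz mz] := zP n; apply: (idom_itv dm dz) => //; exact: ltW.
  rewrite in_itv/= andbT => -[dx mx]; have [n xz] := zI x dx.
  by exists n => //; rewrite /F/= in_itv/= mx.
have intF n : eta.-integrable (F n) (EFin \o slope V).
  by apply: (slope_itv_integrable hV) => //; have [] := zP n.
have mF n : measurable (F n) by exact: measurable_itv.
have mUF : measurable (\bigcup_n F n) by exact: bigcup_measurable.
have E : EFin \o (fun x => slope V x - c) = ((EFin \o slope V) \- (EFin \o cst c))%E.
  by apply/funext => x /=; rewrite EFinB.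
have H : eta.-integrable (\bigcup_n F n) (EFin \o (fun x => slope V x - c)).
  apply: (@integrable_exhaustion _ _ _ _ _ _ (dens V m + `|c|)) => //.
  - by move=> n k nk; apply/subsetPset => x; rewrite /F /= !in_itv/= => /andP[-> xz]/=; apply: le_trans xz _; exact: ndz.
  - by apply: measurable_funB => //; exact: (measurable_slope cV).
  - move=> n x; rewrite /F/= in_itv/= => /andP[mx xz]; have [dz _] := zP n.
    have dx : I x by apply: (idom_itv dm dz) => //; exact: ltW.
    by rewrite slopeE// subr_ge0 rslope_nd// ltW.
  - by move=> n; have K := integrableB (mF n) (intF n) (cst_integrable c (mF n)); rewrite E.
  - move=> n; rewrite (RintegralB (mF n) (intF n) (cst_integrable c (mF n))).
    have [dz mz] := zP n; rewrite (Rintegral_slope hV)// Rintegral_cst//.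
    have /andP[h0 h1] := mass_le1 (measurable_itv _ : measurable (F n)).
    have := dens_gt0 V (z n); have := ler_norm (- c); rewrite normrN.
    by have := normr_ge0 c; rewrite -/(F n); nra.
rewrite -UF (_ : EFin \o slope V = ((EFin \o (fun x => slope V x - c)%R) \+ (EFin \o cst c))%E).
  by have K := integrableD mUF H (cst_integrable c mUF).
by apply/funext => x /=; rewrite -EFinD subrK.
Qed.

Lemma slope_integrable_left m : I m ->
  eta.-integrable (I `&` `]-oo, m]) (EFin \o slope V).
Proof.
move=> dm; pose c := rslope V m.
have [|||z [ndz zP zI]] := @interval_exhaustion _ [set x | I (- x)] (- m).
- by move=> a b da db x /andP[ax xb]; apply: (idom_itv db da); rewrite lerN2.
- move=> x dx; have [u du ux] := idom_left cV dx.
  by exists (- u) => /=; rewrite ?opprK// ltrNr.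
- by rewrite /= opprK.
pose F n : set (measurableTypeR R) := `](- z n), m]%classic.
have UF : \bigcup_n F n = I `&` `]-oo, m].
  apply/seteqP; split => x /=.
    move=> [n _]; rewrite /F/= in_itv/= => /andP[mx xz].
    rewrite in_itv/= xz; split => //.
    by have [dz mz] := zP n; apply: (idom_itv dz dm) => //; exact: ltW.
  rewrite in_itv/= => -[dx mx]; have [u du ux] := idom_left cV dx.
  have [n xz] := zI (- u) ltac:(by rewrite /= opprK).
  by exists n => //; rewrite /F/= in_itv/= mx andbT; lra.
have intF n : eta.-integrable (F n) (EFin \o slope V).
  by apply: (slope_itv_integrable hV) => //; have [] := zP n.
have mF n : measurable (F n) by exact: measurable_itv.
have mUF : measurable (\bigcup_n F n) by exact: bigcup_measurable.
have E : EFin \o (fun x => c - slope V x) = ((EFin \o cst c) \- (EFin \o slope V))%E.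
  by apply/funext => x /=; rewrite EFinB.
have H : eta.-integrable (\bigcup_n F n) (EFin \o (fun x => c - slope V x)).
  apply: (@integrable_exhaustion _ _ _ _ _ _ (dens V m + `|c|)) => //.
  - move=> n k nk; apply/subsetPset => x; rewrite /F /= !in_itv/= => /andP[xz ->]/=.
    by rewrite andbT (le_lt_trans _ xz)// lerN2; exact: ndz.
  - by apply: measurable_funB => //; exact: (measurable_slope cV).
  - move=> n x; rewrite /F/= in_itv/= => /andP[mx xz]; have [dz _] := zP n.
    have dx : I x by apply: (idom_itv dz dm) => //; exact: ltW.
    by rewrite slopeE// subr_ge0 rslope_nd.
  - by move=> n; have K := integrableB (mF n) (cst_integrable c (mF n)) (intF n); rewrite E.
  - move=> n; rewrite (RintegralB (mF n) (cst_integrable c (mF n)) (intF n)).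
    have [dz mz] := zP n; rewrite (Rintegral_slope hV)//; last by rewrite lerNl.
    rewrite Rintegral_cst//.
    have /andP[h0 h1] := mass_le1 (measurable_itv _ : measurable (F n)).
    have := dens_gt0 V (- z n); have := ler_norm c.
    by have := normr_ge0 c; rewrite -/(F n); nra.
rewrite -UF (_ : EFin \o slope V = ((EFin \o cst c) \- (EFin \o (fun x => c - slope V x)%R))%E).
  by have K := integrableB mUF (cst_integrable c mUF) H.
by apply/funext => x /=; rewrite -EFinB subKr.
Qed.

Lemma slope_integrable : eta.-integrable [set: R] (EFin \o slope V).
Proof.
have [m dm] := idom_nonempty hV.
have E : I = (I `&` `]-oo, m]) `|` (I `&` `]m, +oo[).
  by rewrite -setIUr -itv_bndbnd_setU// set_itvE setIT.
have mI : measurable (I : set (measurableTypeR R)) := measurable_idom V.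
have mS : measurable_fun [set: measurableTypeR R] (EFin \o slope V).
  by apply/measurable_EFinP; exact: (measurable_slope cV).
have H : eta.-integrable I (EFin \o slope V).
  rewrite {1}E; apply/integrableP; split.
    apply: measurable_funTS; apply/measurable_EFinP; exact: (measurable_slope cV).
  rewrite ge0_integral_setU//=.
  - rewrite lte_add_pinfty//.
      by have /integrableP[] := slope_integrable_left dm.
    by have /integrableP[] := slope_integrable_right dm.
  - exact: measurableI.
  - exact: measurableI.
  - apply: measurable_funTS; exact: (measurableT_comp (@abse_measurable R setT) mS).

  - apply/disj_setPS => x [/= [_ +] [_ +]]; rewrite !in_itv/= andbT => xm mx.
    by rewrite ltNge xm in mx.
have := (integrable_mkcond _ mI).1 H.
rewrite (_ : _ \_ I = EFin \o slope V)//.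
by apply/funext => x; rewrite patchE; case: ifPn => //= /negP nx; rewrite slope_out// => dx; apply: nx; rewrite inE.
Qed.

End SlopeIntegrals.

(** * Integrals of the slope over half-lines *)

Section Blocks.
Context {R : realType}.
Variables (eta : probability (measurableTypeR R) R) (V : R -> \bar R).
Hypothesis hV : is_potential eta V.
Hypothesis ec : essentially_continuous eta V.

Local Notation I := (idom V).

Let cV : convex_lsc V := proj1 hV.

Lemma eta_null_subset (A : set (measurableTypeR R)) : measurable A ->
  A `<=` ~` I -> eta A = 0%E.
Proof.
move=> mA AI; apply/eqP; rewrite eq_le measure_ge0 andbT.
rewrite -(eta_out_idom hV) le_measure ?inE//.
by apply: measurableC; exact: measurable_idom.
Qed.

(** The half-lines that end in the domain decrease to a set that misses the
    domain, hence is null. *)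
Lemma small_mass_left e : 0 < e ->
  exists2 y, I y & fine (eta `]-oo, y]%classic) < e.
Proof.
move=> e0; apply: contrapT => /forall2NP H.
have [m dm] := idom_nonempty hV.
have [|||z [ndz zP zI]] := @interval_exhaustion _ [set x | I (- x)] (- m).
- by move=> a b da db x /andP[ax xb]; apply: (idom_itv db da); rewrite lerN2.
- move=> x dx; have [u du ux] := idom_left cV dx.
  by exists (- u) => /=; rewrite ?opprK// ltrNr.
- by rewrite /= opprK.
pose F n : set (measurableTypeR R) := `]-oo, (- z n)]%classic.
have mF n : measurable (F n) by exact: measurable_itv.
have mC : measurable (\bigcap_n F n) by exact: bigcap_measurable.
have cv : (eta \o F) n @[n --> \oo] --> eta (\bigcap_n F n).
  apply: nonincreasing_cvg_mu => //.
    by rewrite -ge0_fin_numE// fin_num_measure.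
  move=> n k nk; apply/subsetPset => x; rewrite /F/= !in_itv/= => xz.
  by rewrite (le_trans xz)// lerN2; exact: ndz.
have : (e%:E <= eta (\bigcap_n F n))%E.
  rewrite -(cvg_lim _ cv)//; apply: lime_ge; first by apply/cvg_ex; eexists; exact: cv.
  apply: nearW => n /=; rewrite -[leRHS]fineK ?fin_num_measure// lee_fin leNgt.
  by apply/negP => Fe; have [] := H (- z n) => //; apply; have [] := zP n.
rewrite eta_null_subset//; first by rewrite lee_fin leNgt e0.
move=> x Fx dx; have [u du ux] := idom_left cV dx.
have [n un] := zI (- u) ltac:(by rewrite /= opprK).
by have := Fx n Logic.I; rewrite /F/= in_itv/= => xz; lra.
Qed.

Lemma small_mass_right e : 0 < e ->
  exists2 y, I y & fine (eta `]y, +oo[%classic) < e.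
Proof.
move=> e0; apply: contrapT => /forall2NP H.
have [m dm] := idom_nonempty hV.
have [z [ndz zP zI]] := interval_exhaustion (@idom_interval _ V)
  (fun x dx => let: ex_intro2 w a b := idom_right cV dx in ex_intro2 _ _ w a b) dm.
pose F n : set (measurableTypeR R) := `](z n), +oo[%classic.
have mF n : measurable (F n) by exact: measurable_itv.
have mC : measurable (\bigcap_n F n) by exact: bigcap_measurable.
have cv : (eta \o F) n @[n --> \oo] --> eta (\bigcap_n F n).
  apply: nonincreasing_cvg_mu => //.
    by rewrite -ge0_fin_numE// fin_num_measure.
  move=> n k nk; apply/subsetPset => x; rewrite /F/= !in_itv/= !andbT => xz.
  by rewrite (le_lt_trans _ xz)//; exact: ndz.
have : (e%:E <= eta (\bigcap_n F n))%E.
  rewrite -(cvg_lim _ cv)//; apply: lime_ge; first by apply/cvg_ex; eexists; exact: cv.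
  apply: nearW => n /=; rewrite -[leRHS]fineK ?fin_num_measure// lee_fin leNgt.
  by apply/negP => Fe; have [] := H (z n) => //; apply; have [] := zP n.
rewrite eta_null_subset//; first by rewrite lee_fin leNgt e0.
move=> x Fx dx; have [n un] := zI _ dx.
by have := Fx n Logic.I; rewrite /F/= in_itv/= andbT => xz; lra.
Qed.

Let intS (A : set (measurableTypeR R)) : measurable A ->
  eta.-integrable A (EFin \o slope V).
Proof.
by move=> mA; apply: integrableS (slope_integrable hV).
Qed.

Let Rint_le (A : set (measurableTypeR R)) (k : R) : measurable A ->
  (forall x, A x -> slope V x <= k) ->
  \int[eta]_(x in A) slope V x <= k * fine (eta A).
Proof.
move=> mA H; rewrite -Rintegral_cst//; apply: le_Rintegral => //; first exact: intS.
exact: finite_measure_integrable_cst.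
Qed.

Let Rint_ge (A : set (measurableTypeR R)) (k : R) : measurable A ->
  (forall x, A x -> k <= slope V x) ->
  k * fine (eta A) <= \int[eta]_(x in A) slope V x.
Proof.
move=> mA H; rewrite -Rintegral_cst//; apply: le_Rintegral => //; last exact: intS.
exact: finite_measure_integrable_cst.
Qed.

Let mass_mono (A B : set (measurableTypeR R)) : measurable A -> measurable B ->
  A `<=` B -> fine (eta A) <= fine (eta B).
Proof.
by move=> mA mB AB; rewrite fine_le ?fin_num_measure// le_measure ?inE.
Qed.

(** Up to y near the left end, the slope is at most |V' x| on a set of small
    mass; from y to x its integral is dens y - dens x, with dens y small by
    [dens_decay_left]. *)
Lemma slope_block_left x : I x ->
  \int[eta]_(z in `]-oo, x]) slope V z <= - dens V x.
Proof.
move=> dx; apply/ler_addgt0Pr => e e0.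
pose k := `|rslope V x|; have k0 : 0 <= k by exact: normr_ge0.
pose e' := e / (k + 1).
have e'0 : 0 < e' by rewrite divr_gt0// ltr_wpDl.
have [y0 dy0 ey0] := small_mass_left e'0.
have dmin : I (Num.min y0 x) by rewrite /Num.min; case: ifP.
have [y [dy yle] ye] := dens_decay_left hV ec dmin e'0.
have [yy0 yx] : y <= y0 /\ y <= x by move: yle; rewrite le_min => /andP[].
have E : `]-oo, x]%classic = `]-oo, y] `|` `]y, x] :> set (measurableTypeR R).
  by rewrite -itv_bndbnd_setU.
rewrite E Rintegral_setU//; last 2 first.
- by rewrite -E; exact: intS.
- apply/disj_setPS => z [/=]; rewrite !in_itv/= => zy /andP[yz _].
  by rewrite ltNge zy in yz.
rewrite (Rintegral_slope hV)//.
have h1 : \int[eta]_(z in `]-oo, y]) slope V z <= k * fine (eta `]-oo, y]%classic).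
  apply: Rint_le => // z; rewrite /= in_itv/= => zy.
  have [dz|nz] := pselect (I z); last by rewrite slope_out.
  rewrite slopeE//; apply: le_trans (ler_norm _).
  by apply: rslope_nd => //; exact: le_trans yx.
have h2 : fine (eta `]-oo, y]%classic) <= fine (eta `]-oo, y0]%classic).
  by apply: mass_mono => // z; rewrite /= !in_itv/= => /le_trans; exact.
have h3 : k * fine (eta `]-oo, y]%classic) <= k * e' by rewrite ler_wpM2l//; lra.
have : (k + 1) * e' = e by rewrite /e' mulrC divfK// gt_eqF// ltr_wpDl.
lra.
Qed.

Lemma slope_block_right x : I x ->
  dens V x <= \int[eta]_(z in `]x, +oo[) slope V z.
Proof.
move=> dx; apply/ler_addgt0Pr => e e0.
pose k := `|rslope V x|; have k0 : 0 <= k by exact: normr_ge0.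
pose e' := e / (k + 1).
have e'0 : 0 < e' by rewrite divr_gt0// ltr_wpDl.
have [y0 dy0 ey0] := small_mass_right e'0.
have dmax : I (Num.max y0 x) by rewrite /Num.max; case: ifP.
have [y [dy yle] ye] := dens_decay_right hV ec dmax e'0.
have [yy0 yx] : y0 <= y /\ x <= y by move: yle; rewrite ge_max => /andP[].
have E : `]x, +oo[%classic = `]x, y] `|` `]y, +oo[ :> set (measurableTypeR R).
  by rewrite -itv_bndbnd_setU.
rewrite E Rintegral_setU//; last 2 first.
- by rewrite -E; exact: intS.
- apply/disj_setPS => z [/=]; rewrite !in_itv/= andbT => /andP[_ zy] yz.
  by rewrite ltNge zy in yz.
rewrite (Rintegral_slope hV)//.
have h1 : - k * fine (eta `]y, +oo[%classic) <= \int[eta]_(z in `]y, +oo[) slope V z.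
  apply: Rint_ge => // z; rewrite /= in_itv/= andbT => yz.
  have [dz|nz] := pselect (I z); last by rewrite slope_out// oppr_le0.
  rewrite slopeE//; apply: (@le_trans _ _ (rslope V x)).
    by rewrite lerNl /k -normrN ler_norm.
  by apply: rslope_nd => //; apply: le_trans yx _; exact: ltW.
have h2 : fine (eta `]y, +oo[%classic) <= fine (eta `]y0, +oo[%classic).
  by apply: mass_mono => // z; rewrite /= !in_itv/= !andbT; exact: le_lt_trans.
have h3 : k * fine (eta `]y, +oo[%classic) <= k * e' by rewrite ler_wpM2l//; lra.
have : (k + 1) * e' = e by rewrite /e' mulrC divfK// gt_eqF// ltr_wpDl.
lra.
Qed.

(** By [slope_block_right] the density is at most the integral of |V'|. *)
Lemma dens_bounded : exists2 C, 0 < C & forall x, I x -> dens V x <= C.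
Proof.
pose C := \int[eta]_z `|slope V z|.
have H x : I x -> dens V x <= C.
  move=> dx; apply: (le_trans (slope_block_right dx)).
  apply: (@le_trans _ _ (\int[eta]_(z in `]x, +oo[) `|slope V z|)).
    apply: le_Rintegral => //; [exact: intS|exact/integrable_norm/intS|].
    by move=> z _; exact: ler_norm.
  rewrite /C -(setUv (`]x, +oo[ : set (measurableTypeR R))) Rintegral_setU//.
  - by rewrite lerDl; apply: Rintegral_ge0.
  - exact: measurableC.
  - by rewrite setUv; exact/integrable_norm/intS.
  - by apply/disj_setPS; rewrite setICr.
have [m dm] := idom_nonempty hV.
by exists C => //; apply: lt_le_trans (H m dm); exact: dens_gt0.
Qed.

End Blocks.

(** * Quantiles *)

(** Valid for functions of any sign and any integrability, because the positive
    and the negative parts are transported separately. *)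
Lemma integral_law d1 d2 (X : measurableType d1) (Y : measurableType d2)
    (R : realType) (phi : X -> Y) (P : {measure set X -> \bar R})
    (L : {measure set Y -> \bar R}) (f : Y -> \bar R) :
  measurable_fun [set: X] phi ->
  (forall A, measurable A -> L A = P (phi @^-1` A)) ->
  measurable_fun [set: Y] f ->
  (\int[L]_y f y = \int[P]_x f (phi x))%E.
Proof.
move=> mphi LP mf.
have ge0 (g : Y -> \bar R) : measurable_fun [set: Y] g -> (forall y, 0 <= g y)%E ->
    (\int[L]_y g y = \int[P]_x g (phi x))%E.
  move=> mg g0; rewrite -[RHS](@ge0_integral_pushforward _ _ _ _ _ _ mphi P setT)//.
  by apply: eq_measure_integral => A mA _; rewrite /= LP.
rewrite integralE [RHS]integralE; congr (_ - _)%E.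
- rewrite ge0//; first by apply: eq_integral => x _; rewrite !funeposE.
  exact: measurable_funepos.
- rewrite ge0//; first by apply: eq_integral => x _; rewrite !funenegE.
  exact: measurable_funeneg.
Qed.

Section Quantile.
Context {R : realType}.
Variables (eta : probability (measurableTypeR R) R) (V : R -> \bar R).
Hypothesis hV : is_potential eta V.
Hypothesis ec : essentially_continuous eta V.

Local Notation I := (idom V).
Local Notation unif := (uniform_prob (@ltr01 R)).

Let cV : convex_lsc V := proj1 hV.

Definition cumul (x : R) : R := fine (eta `]-oo, x]%classic).

Lemma cumul_itv u v : u <= v -> cumul v - cumul u = fine (eta `]u, v]%classic).
Proof.
move=> uv; rewrite /cumul.
have -> : `]-oo, v]%classic = `]-oo, u] `|` `]u, v] :> set (measurableTypeR R).
  by rewrite -itv_bndbnd_setU.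
rewrite measureU//.
  by rewrite fineD ?fin_num_measure// addrC addKr.
by apply/seteqP; split => // z [/=]; rewrite !in_itv/= => zu /andP[uz _]; rewrite ltNge zu in uz.
Qed.

Lemma cumul_right x : fine (eta `]x, +oo[%classic) = 1 - cumul x.
Proof.
have : eta setT = 1%E by exact: probability_setT.
rewrite /cumul (_ : setT = `]-oo, x] `|` `]x, +oo[ :> set (measurableTypeR R)); last first.
  by rewrite -itv_bndbnd_setU// set_itvE.
rewrite measureU//.
  by move=> /(congr1 fine); rewrite fineD ?fin_num_measure//= => <-; rewrite addrC addKr.
by apply/seteqP; split => // z [/=]; rewrite !in_itv/= andbT => zx xz; rewrite ltNge zx in xz.
Qed.

Lemma cumul_nd u v : u <= v -> cumul u <= cumul v.
Proof. by move=> uv; rewrite -subr_ge0 cumul_itv// fine_ge0. Qed.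

Lemma expeR_potential_bounded : exists2 C, 0 < C &
  forall z, (0%:E <= expeR (- V z) <= C%:E)%E.
Proof.
have [C C0 HC] := dens_bounded hV ec; exists C => // z.
rewrite expeR_ge0/=; have [dz|nz] := pselect (I z).
  by rewrite (expeR_dens hV) ?lee_fin ?HC//; exact: idom_fin dz.
suff -> : V z = +oo%E by rewrite /= lee_fin ltW.
have [h|h|[u [w [uzw Voo]]]] := out_idom (idom_nonempty hV) nz.
- exact: (potential_idom_inf hV ec h).
- exact: (potential_idom_sup hV ec h).
- exact: Voo.
Qed.

(** The density is bounded, so the distribution function is Lipschitz. *)
Lemma cumul_continuous : continuous cumul.
Proof.
have [C C0 HC] := expeR_potential_bounded.
have lip u v : u <= v -> `|cumul v - cumul u| <= C * (v - u).
  move=> uv; rewrite ger0_norm ?subr_ge0 ?cumul_nd// cumul_itv//.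
  suff /andP[] : 0 * (v - u) <= fine (eta `]u, v]%classic) <= C * (v - u) by [].
  by apply: (potential_itv_mass hV) => // z _ _; exact: HC.
have lip' u v : `|cumul u - cumul v| <= C * `|u - v|.
  have [uv|/ltW vu] := leP u v.
    by rewrite distrC (distrC u) (ger0_norm (_ : 0 <= v - u)) ?subr_ge0// lip.
  by rewrite (ger0_norm (_ : 0 <= u - v)) ?subr_ge0// lip.
move=> x; apply/cvgrPdist_le => e e0; near=> y.
apply: (le_trans (lip' x y)); rewrite -ler_pdivlMl//.
near: y; exists (C^-1 * e); first by rewrite /= mulr_gt0// invr_gt0.
by move=> y /= /ltW.
Unshelve. all: by end_near. Qed.

Lemma cumul_surj t : 0 < t < 1 -> exists x, cumul x = t.
Proof.
move=> /andP[t0 t1].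
have [a _ Ha] := small_mass_left hV t0.
have [b _ Hb] := small_mass_right hV (ltac:(lra) : 0 < 1 - t).
rewrite cumul_right in Hb; rewrite -/(cumul a) in Ha.
have ab : a <= b.
  rewrite leNgt; apply/negP => ba; have := cumul_nd (ltW ba); lra.
have [] := @IVT _ cumul a b t ab.
- by apply: continuous_subspaceT => x; exact: cumul_continuous.
- by rewrite ge_min le_max; apply/andP; split; apply/orP; [left|right]; lra.
- by move=> x _ xt; exists x.
Qed.

(** A point outside the domain has no mass on one of its sides. *)
Lemma cumul_idom x : 0 < cumul x < 1 -> I x.
Proof.
move=> /andP[F0 F1]; apply: contrapT => nx.
have [h|h] := pselect (exists2 m, I m & m < x).
  have H : `]x, +oo[%classic `<=` ~` I.
    move=> z; rewrite /= in_itv/= andbT => xz dz; apply: nx; case: h => m dm mx.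
    by apply: (idom_itv dm dz); exact: ltW.
  have := cumul_right x; rewrite (eta_null_subset hV (measurable_itv _) H)/=; lra.
have H : `]-oo, x]%classic `<=` ~` I.
  move=> z; rewrite /= in_itv/= le_eqVlt => /orP[/eqP->//|zx dz].
  by apply: h; exists z.
by move: F0; rewrite /cumul (eta_null_subset hV (measurable_itv _) H)/= ltxx.
Qed.

(** Any preimage serves: preimages of two levels are ordered like the levels. *)
Definition quant0 (t : R) : R := xget 0 [set x | cumul x = t].
(** The value 0 outside ]0, 1[ makes it measurable on the whole line. *)
Definition quant : R -> R := quant0 \_ `]0, 1[.

Lemma cumul_quant t : 0 < t < 1 -> cumul (quant t) = t.
Proof.
move=> t01; rewrite /quant patchE mem_set ?/=; last by rewrite /= in_itv.
rewrite /quant0; have [x xt] := cumul_surj t01.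
exact: (@xgetPex _ 0 [set x | cumul x = t] (ex_intro _ x xt)).
Qed.

Lemma quant_idom t : 0 < t < 1 -> I (quant t).
Proof. by move=> t01; apply: cumul_idom; rewrite cumul_quant. Qed.

Lemma quant_nd s t : 0 < s -> s <= t -> t < 1 -> quant s <= quant t.
Proof.
move=> s0 st t1; rewrite leNgt; apply/negP => ts.
have := cumul_nd (ltW ts); rewrite !cumul_quant; [|lra..] => ts'.
have E : s = t by lra.
by move: ts; rewrite E ltxx.
Qed.

Lemma measurable_quant : measurable_fun [set: measurableTypeR R] (quant : _ -> measurableTypeR R).
Proof.
have m01 : measurable (`]0, 1[%classic : set (measurableTypeR R)) by exact: measurable_itv.
apply/(measurable_restrictT _ m01).
move=> _; apply: (measurability _ (RGenCInfty.measurableE R)) => // _ [_ [r ->] <-].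
apply: is_interval_measurable => s t [s01] /= rs [t01] _ u /andP[su ut].
move: s01 t01; rewrite /= !in_itv/= => /andP[s0 s1] /andP[t0 t1].
have u01 : 0 < u < 1 by lra.
split; first exact: u01.
move: rs; rewrite !andbT !in_itv/= !andbT => rs; apply: (le_trans rs).
have := @quant_nd s u s0 su ltac:(lra).
by rewrite /quant !patchE !mem_set//= in_itv/=; lra.
Qed.

Lemma uniform_measureE (A : set (measurableTypeR R)) : measurable A ->
  unif A = lebesgue_measure (A `&` `[0, 1]).
Proof.
move=> mA; rewrite /uniform_prob integral_uniform_pdf.
rewrite (eq_integral (cst 1%E)); last first.
  by move=> x /set_mem[_ /=]; rewrite in_itv/= /uniform_pdf => ->; rewrite subr0 invr1.
by rewrite integral_cst ?mul1e//; apply: measurableI.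
Qed.

Lemma uniform_out01 : unif (~` `]0, 1[%classic) = 0%E.
Proof.
rewrite uniform_measureE; last by apply: measurableC.
apply: countable_lebesgue_measure0.
apply: (@sub_countable _ _ _ [set 0; 1]).
  apply: subset_card_le => x [/= /negP + ]; rewrite !in_itv/= => h /andP[x0 x1].
  move: h; rewrite negb_and -!leNgt => /orP[h|h].
  - by left; apply/eqP; rewrite eq_le h.
  - by right; apply/eqP; rewrite eq_le h andbT.
exact/finite_set_countable/finite_set2.
Qed.

(** Half-lines ]x, +oo[ generate the Borel sets, and inside ]0, 1[ their
    preimage lies between ]F x, 1[ and [F x, 1]. *)
Lemma quant_law (A : set (measurableTypeR R)) : measurable A ->
  eta A = unif (quant @^-1` A).
Proof.
move=> mA.
pose mixin := isMeasurableFun.Build _ _ _ _ _ measurable_quant.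
pose Q : {mfun measurableTypeR R >-> measurableTypeR R} := HB.pack quant mixin.
rewrite -[RHS]/(distribution unif Q A).
apply: (@measure_unique _ R (measurableTypeR R) [set A | exists x, A = `]x, +oo[%classic] (fun n => `](- n%:R), +oo[%classic)) => //.
- exact: RGenOInfty.measurableE.
- move=> _ _ [x ->] [y ->]; exists (Num.max x y).
  by apply/seteqP; split => z /=; rewrite !in_itv/= !andbT gt_max; [case=> -> ->|case/andP].
- by move=> n; exists (- n%:R).
- apply/seteqP; split => // x _; exists (Num.truncn `|x|).+1 => //=.
  rewrite in_itv/= andbT ltrNl; apply: le_lt_trans (truncnS_gt _).
  by rewrite -normrN ler_norm.
- move=> _ [x ->]; rewrite /distribution /pushforward/= -[LHS]fineK ?fin_num_measure// cumul_right.
  set B := _ @^-1` _.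
  have mB : measurable (B : set (measurableTypeR R)).
    by rewrite -[X in measurable X]setTI; apply: measurable_quant.
  have F0 : 0 <= cumul x by exact: fine_ge0.
  have F1 : cumul x <= 1 by have := cumul_right x; have := fine_ge0 (measure_ge0 eta `]x, +oo[%classic); lra.
  rewrite uniform_measureE//; apply/eqP; rewrite eq_le; apply/andP; split.
    apply: (@le_trans _ _ (lebesgue_measure `]cumul x, 1[%classic)).
      by rewrite lebesgue_measure_itv/= lte_fin; case: ltP => //; rewrite lee_fin; lra.
    apply: le_measure; rewrite ?inE//; first exact: measurableI.
    move=> t; rewrite /= in_itv/= => /andP[xt t1]; split; last by rewrite /= in_itv/=; lra.
    rewrite /B/= in_itv/= andbT ltNge; apply/negP => qx.
    by have := cumul_nd qx; rewrite cumul_quant; lra.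
  apply: (@le_trans _ _ (lebesgue_measure (`[cumul x, 1] `|` [set 0; 1]))).
    apply: le_measure; rewrite ?inE//; [exact: measurableI|apply: measurableU => //|].
      by apply: measurableU; exact: measurable_set1.
    move=> t [qx] /=; rewrite !in_itv/= => /andP[t0 t1].
    have [->|nt0] := eqVneq t 0; first by right; left.
    have [->|nt1] := eqVneq t 1; first by right; right.
    have t01 : 0 < t < 1 by rewrite !lt_neqAle eq_sym nt0 nt1 t0 t1.
    left; move: qx; rewrite /B/= in_itv/= andbT t1 andbT => /ltW /cumul_nd.
    by rewrite cumul_quant.
  have m2 : measurable ([set 0; 1] : set (measurableTypeR R)).
    by apply: measurableU; exact: measurable_set1.
  have := @measureU2 _ _ _ (@lebesgue_measure R) _ _ (measurable_itv `[cumul x, 1]) m2.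
  move=> /le_trans; apply.
  rewrite [X in (_ + X)%E](countable_lebesgue_measure0 (finite_set_countable (finite_set2 _ _))).
  have L : (lebesgue_measure [set` `[cumul x, 1%R]] <= (1 - cumul x)%:E)%E.
    by rewrite lebesgue_measure_itv/= lte_fin; case: ltP => //; rewrite lee_fin; lra.
  by rewrite adde0; exact: L.
- by move=> n; rewrite -ge0_fin_numE// fin_num_measure.
Qed.

Lemma integral_quant (f : R -> \bar R) : measurable_fun [set: measurableTypeR R] f ->
  (\int[eta]_x f x = \int[unif]_t f (quant t))%E.
Proof.
move=> mf; apply: integral_law => //; first exact: measurable_quant.
by move=> A mA; exact: quant_law.
Qed.

End Quantile.

(** * Young inequality, minorants and blocks *)

Section Fenchel.
Context {R : realType}.
Implicit Types f : R -> \bar R.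

Lemma young_fenchel f a b : (forall x, -oo < f x)%E -> (exists x, f x < +oo)%E ->
  ((a * b)%:E <= f a + fenchel f b)%E.
Proof.
move=> fN [x0 fx0].
have H x : ((x * b)%:E - f x <= fenchel f b)%E.
  by apply: ereal_sup_ubound; exists x.
have psiN : (-oo < fenchel f b)%E.
  apply: (lt_le_trans _ (H x0)); move: (fN x0) fx0.
  by case: (f x0) => // r _ _; rewrite -EFinB ltNyr.
have := fN a; case E : (f a) => [r| |] //= _; last by rewrite addye ?leey// gt_eqF.
by have := H a; rewrite E leeBlDl.
Qed.

(** A supremum of continuous functions. *)
Lemma fenchel_lsc f : (forall x, -oo < f x)%E -> lower_semicontinuous (fenchel f).
Proof.
move=> fN y a /ereal_sup_gt[_ [x _ <-]].
have := fN x; case E : (f x) => [r| |] //= _; rewrite -EFinB lte_fin => ay.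
pose d := (x * y - r - a) / (`|x| + 1).
have x1 : 0 < `|x| + 1 by rewrite ltr_wpDl.
have d0 : 0 < d by rewrite divr_gt0//; lra.
exists (ball y d); first exact: nbhsx_ballx.
move=> z; rewrite /ball/= => yz.
apply: (@lt_le_trans _ _ ((x * z)%:E - f x)%E); last first.
  by apply: ereal_sup_ubound; exists x.
rewrite E -EFinB lte_fin.
have : `|x * (y - z)| < x * y - r - a.
  rewrite normrM; apply: (@le_lt_trans _ _ (`|x| * d)).
    by rewrite ler_wpM2l// ltW.
  have -> : x * y - r - a = (`|x| + 1) * d by rewrite /d; field; rewrite gt_eqF.
  by rewrite mulrDl mul1r ltrDl.
by have := ler_norm (x * (y - z)); lra.
Qed.

Lemma fenchel_minorant f : (forall x, -oo < f x)%E -> (exists x, f x < +oo)%E ->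
  exists C, forall y, ((- (C * (1 + `|y|)))%:E <= fenchel f y)%E.
Proof.
move=> fN [x0 fx0]; have := fN x0; case E : (f x0) fx0 => [r| |] // _ _.
exists (`|x0| + `|r|) => y; apply: (@le_trans _ _ ((x0 * y)%:E - f x0)%E); last first.
  by apply: ereal_sup_ubound; exists x0.
rewrite E -EFinB lee_fin.
have h1 := ler_norm (- (x0 * y)); rewrite normrN normrM in h1.
have h2 := ler_norm r; have h3 := normr_ge0 r; have h4 := normr_ge0 x0.
have h5 := normr_ge0 y; nra.
Qed.

(** If f is finite at p < q, let m be their midpoint: on the right of m, f lies
    above the line through p and m, on the left of m above the line through m
    and q.  If f is finite at p only, it is bounded below by its value there. *)
Lemma convex_minorant f : convex_lsc f -> (exists x, f x < +oo)%E ->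
  exists C, forall y, ((- (C * (1 + `|y|)))%:E <= f y)%E.
Proof.
move=> cf [p fp].
have [[q fq pq]|nq] := pselect (exists2 q, (f q < +oo)%E & q != p); last first.
  exists `|rpot f p| => y; have [->|yp] := eqVneq y p.
    rewrite (potential_fin cf fp) lee_fin.
    have := ler_norm (- rpot f p); rewrite normrN.
    have := normr_ge0 (rpot f p); have := normr_ge0 p; nra.
  suff -> : f y = +oo%E by rewrite leey.
  apply/eqP; rewrite -leye_eq leNgt; apply/negP => fy.
  by apply: nq; exists y.
wlog {pq}pq : p q fp fq / p < q.
  move=> H; move: (pq); rewrite neq_lt => /orP[qp|pq']; first exact: (H q p).
  exact: (H p q).
pose m := (p + q) / 2; have pm : p < m by rewrite /m; lra.
have mq : m < q by rewrite /m; lra.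
have [fm _] := potential_chord cf pm mq fp fq.
pose s1 := (rpot f m - rpot f p) / (m - p).
pose s2 := (rpot f q - rpot f m) / (q - m).
pose S : R := `|s1| + `|s2|; have S0 : 0 <= S by rewrite addr_ge0.
have key y : (f y < +oo)%E -> rpot f m - S * `|y - m| <= rpot f y.
  move=> fy; have [ym|my|->] := ltgtP y m.
  - have [_ h] := potential_chord cf ym mq fy fq.
    have : rpot f m - rpot f y <= s2 * (m - y).
      by rewrite /s2 mulrAC ler_pdivlMr ?subr_gt0.
    rewrite ltr0_norm ?subr_lt0//.
    have : s2 * (m - y) <= S * (m - y).
      apply: ler_wpM2r; first lra.
      by have := ler_norm s2; have := normr_ge0 s1; rewrite /S; lra.
    lra.
  - have [_ h] := potential_chord cf pm my fp fy.
    have : s1 * (y - m) <= rpot f y - rpot f m.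
      by rewrite /s1 mulrAC ler_pdivrMr ?subr_gt0.
    rewrite gtr0_norm ?subr_gt0//.
    have : - S * (y - m) <= s1 * (y - m).
      apply: ler_wpM2r; first lra.
      by have := ler_norm (- s1); rewrite normrN; have := normr_ge0 s2; rewrite /S; lra.
    lra.
  - by rewrite subrr normr0 mulr0 subr0.
exists (`|rpot f m| + S * (1 + `|m|)) => y; have [fy|fy] := ltP (f y) +oo%E; last first.
  by move: fy; rewrite leye_eq => /eqP ->; rewrite leey.
rewrite (potential_fin cf fy) lee_fin; apply: le_trans (key y fy).
have h1 := ler_norm (- rpot f m); rewrite normrN in h1.
have h2 : S * `|y - m| <= S * (`|y| + `|m|) by rewrite ler_wpM2l// ler_normB.
have h3 := normr_ge0 (rpot f m); have h4 := normr_ge0 y; have h5 := normr_ge0 m.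
have h6 : 0 <= `|rpot f m| * `|y| by rewrite mulr_ge0.
have h7 : 0 <= S * `|m| * `|y| by rewrite !mulr_ge0.
have -> : (`|rpot f m| + S * (1 + `|m|)) * (1 + `|y|) =
  `|rpot f m| + `|rpot f m| * `|y| + S * (`|y| + `|m|) + S + S * `|m| * `|y| by ring.
lra.
Qed.

End Fenchel.

Section Integrals.
Context d (T : measurableType d) (R : realType).
Variable P : probability T R.

(** In the extended reals +oo + -oo is -oo, so the two halves of a transport
    cost have to be kept away from -oo before they are added. *)
Lemma integral_gtNy_of_minorant (g h : T -> \bar R) :
  measurable_fun [set: T] g -> P.-integrable [set: T] h ->
  (forall x, - h x <= g x)%E -> (-oo < \int[P]_x g x)%E.
Proof.
move=> mg ih hg; rewrite ltNye; apply/eqP => E.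
have ihN : P.-integrable [set: T] (h^\+)%E by apply: integrable_funepos.
have gh x : (g^\- x <= h^\+ x)%E.
  rewrite funenegE funeposE ge_max !le_max lexx orbT andbT.
  by rewrite leeNl hg.
have gf : (\int[P]_x g^\- x < +oo)%E.
  apply: (@le_lt_trans _ _ (\int[P]_x h^\+ x)%E).
    apply: ge0_le_integral => //; first exact: measurable_funeneg.
    by have /integrableP[] := ihN.
  exact: integral_funepos_lt_pinfty.
move: E; rewrite integralE.
have : (0 <= \int[P]_x g^\+ x)%E by apply: integral_ge0.
have : (0 <= \int[P]_x g^\- x)%E by apply: integral_ge0.
by move: gf; case: (\int[P]_x g^\- x)%E => // r _ _; case: (\int[P]_x g^\+ x)%E.
Qed.

Lemma integrable_of_fin_num (g : T -> \bar R) : measurable_fun [set: T] g ->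
  (\int[P]_x g x)%E \is a fin_num -> P.-integrable [set: T] g.
Proof.
move=> mg fg; apply/integrableP; split => //.
by apply/abse_integralP => //; rewrite -fin_num_abs.
Qed.

Lemma bounded_above_integral (h : T -> R) (c : R) :
  measurable_fun [set: T] h -> (forall x, h x <= c) ->
  P.-integrable [set: T] (EFin \o h) \/ (\int[P]_x (h x)%:E = -oo)%E.
Proof.
move=> mh hc; have mEh : measurable_fun [set: T] (EFin \o h) by exact/measurable_EFinP.
have H : (-oo < \int[P]_x (- (h x)%:E))%E.
  apply: (@integral_gtNy_of_minorant _ (EFin \o cst c)).
  - by apply: measurableT_comp => //.
  - exact: finite_measure_integrable_cst.
  - by move=> x /=; rewrite lee_fin lerN2.
have [E|] := eqVneq (\int[P]_x (h x)%:E)%E -oo%E; first by right.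
move=> hN; left; apply: integrable_of_fin_num => //.
rewrite fin_numE hN/=; apply/eqP => hy; move: H.
rewrite integralN /= ?hy//.
move: hy; rewrite integralE.
have : (0 <= \int[P]_x (EFin \o h)^\+ x)%E by apply: integral_ge0.
have : (0 <= \int[P]_x (EFin \o h)^\- x)%E by apply: integral_ge0.
by case: (\int[P]_x (EFin \o h)^\- x)%E => //; case: (\int[P]_x (EFin \o h)^\+ x)%E.
Qed.

End Integrals.

(** First fix b and average Young's inequality over B1, which gives an affine
    minorant of psi; then average this minorant over B2.  Iterating avoids the
    product measure. *)
Lemma young_block d1 d2 (T1 : measurableType d1) (T2 : measurableType d2)
    (R : realType) (P1 : probability T1 R) (P2 : probability T2 R)
    (B1 : set T1) (B2 : set T2) (u1 : T1 -> R) (u2 : T2 -> R)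
    (phi psi : R -> \bar R) (t : R) :
  measurable B1 -> measurable B2 -> 0 < t -> P1 B1 = t%:E -> P2 B2 = t%:E ->
  P1.-integrable B1 (EFin \o u1) -> P2.-integrable B2 (EFin \o u2) ->
  P1.-integrable B1 (phi \o u1) -> P2.-integrable B2 (psi \o u2) ->
  (forall b, -oo < psi b)%E ->
  (forall a b, (a * b)%:E <= phi a + psi b)%E ->
  (\int[P1]_(x in B1) u1 x) * (\int[P2]_(x in B2) u2 x) <=
  t * (fine (\int[P1]_(x in B1) phi (u1 x)) + fine (\int[P2]_(x in B2) psi (u2 x))).
Proof.
move=> mB1 mB2 t0 P1t P2t iu1 iu2 iphi ipsi psiN Young.
set A1 := \int[P1]_(x in B1) u1 x; set A2 := \int[P2]_(x in B2) u2 x.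
set k1 := fine (\int[P1]_(x in B1) phi (u1 x)).
set k2 := fine (\int[P2]_(x in B2) psi (u2 x)).
have fk1 : (\int[P1]_(x in B1) phi (u1 x) = k1%:E)%E.
  by rewrite fineK//; exact: (integrable_fin_num mB1 iphi).
have fk2 : (\int[P2]_(x in B2) psi (u2 x) = k2%:E)%E.
  by rewrite fineK//; exact: (integrable_fin_num mB2 ipsi).
have aff d (T : measurableType d) (P : probability T R) B (u : T -> R) b s :
    measurable B -> P.-integrable B (EFin \o u) ->
    P.-integrable B (EFin \o (fun x => u x * b - s)) /\
    \int[P]_(x in B) (u x * b - s) = (\int[P]_(x in B) u x) * b - s * fine (P B).
  move=> mB iu.
  have iub : P.-integrable B (EFin \o (fun x => u x * b)).
    by have := integrableZr mB b iu; apply: eq_integrable.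
  have ics : P.-integrable B (EFin \o cst s) by exact: finite_measure_integrable_cst.
  split; first by have := integrableB mB iub ics; apply: eq_integrable.
  by rewrite (RintegralB mB iub ics) RintegralZr// Rintegral_cst.
have step1 b : (((A1 * b - k1) / t)%:E <= psi b)%E.
  have := psiN b; case E : (psi b) => [s| |] // _; last by rewrite leey.
  rewrite lee_fin ler_pdivrMr// lerBlDl -lerBlDr.
  have [i1 i2] := aff _ _ P1 B1 u1 b s mB1 iu1.
  rewrite P1t/= in i2; rewrite -i2 -lee_fin -fk1 /Rintegral fineK; last first.
    exact: (integrable_fin_num mB1 i1).
  apply: le_integral => // x _; rewrite /= EFinB leeBlDr// -E.
  exact: Young.
have [i1 i2] := aff _ _ P2 B2 u2 (A1 / t) (k1 / t) mB2 iu2.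
have : \int[P2]_(x in B2) (u2 x * (A1 / t) - k1 / t) <= k2.
  rewrite -lee_fin -fk2 /Rintegral fineK; last exact: (integrable_fin_num mB2 i1).
  apply: le_integral => // x _; apply: le_trans (step1 (u2 x)).
  rewrite lee_fin (_ : (A1 * u2 x - k1) / t = u2 x * (A1 / t) - k1 / t)//.
  by field; rewrite gt_eqF.
rewrite i2 P2t/= divfK ?gt_eqF// -/A2 mulrA -(ler_pM2l t0).
have -> : t * (A2 * A1 / t - k1) = A1 * A2 - t * k1 by field; rewrite gt_eqF.
lra.
Qed.

(** * The logarithmic integral, entropy and moment measures *)

Section LogIntegral.
Context {R : realType}.
Local Notation unif := (uniform_prob (@ltr01 R)).

(** From ln y < y applied to y = 1 / sqrt a; it makes a ln a small near 0. *)
Lemma mulr_ln_ge (a : R) : 0 < a -> - Num.sqrt a *+ 2 <= a * ln a.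
Proof.
move=> a0; have s0 : 0 < Num.sqrt a by rewrite sqrtr_gt0.
have E : a = Num.sqrt a ^+ 2 by rewrite sqr_sqrtr// ltW.
have h : - (Num.sqrt a)^-1 <= ln (Num.sqrt a).
  rewrite lerNl -lnV ?posrE//; apply: ltW; apply: ln_sublinear.
  by rewrite invr_gt0.
rewrite {2 3}E lnXn// expr2 mulr2n mulr2n.
have : - Num.sqrt a <= Num.sqrt a * Num.sqrt a * ln (Num.sqrt a).
  rewrite -mulrA; have := ler_wpM2l (ltW (mulr_gt0 s0 s0)) h.
  have -> : Num.sqrt a * Num.sqrt a * - (Num.sqrt a)^-1 = - Num.sqrt a.
    by field; rewrite gt_eqF.
  by rewrite mulrA.
lra.
Qed.

(** A primitive of - ln t - ln (1 - t) is 2 t - t ln t + (1 - t) ln (1 - t). *)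
Lemma integral_logt_itv (a : R) : 0 < a -> a < 1 / 2 ->
  (\int[lebesgue_measure]_(t in `[a, (1 - a)%R]) (- ln t - ln (1 - t))%:E =
   (2 * (1 - 2 * a) + 2 * (a * ln a) - 2 * ((1 - a) * ln (1 - a)))%:E)%E.
Proof.
move=> a0 a12.
pose F (t : R) := 2 * t - t * ln t + (1 - t) * ln (1 - t).
have dF (t : R) : 0 < t -> t < 1 -> is_derive t 1 F (- ln t - ln (1 - t)).
  move=> t0 t1; have t1' : 0 < 1 - t by lra.
  have d2 := is_derive1_ln t1'; have d1 := is_derive1_ln t0.
  apply: is_derive_eq; rewrite /GRing.scale/=; field.
  by rewrite !gt_eqF.
have cF (t : R) : 0 < t -> t < 1 -> {for t, continuous F}.
  move=> t0 t1; apply/differentiable_continuous/derivable1_diffP.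
  by have [] := dF t t0 t1.
have -> : (2 * (1 - 2 * a) + 2 * (a * ln a) - 2 * ((1 - a) * ln (1 - a)))%:E = ((F (1 - a))%:E - (F a)%:E)%E.
  rewrite -EFinB /F; congr EFin; have -> : 1 - (1 - a) = a by lra.
  by lra.
apply: continuous_FTC2; first lra.
- apply: continuous_in_subspaceT => t; rewrite inE/= in_itv/= => /andP[at_ t1].
  apply: cvgB.
    by apply: cvgN; apply: continuous_ln; lra.
  apply: (@continuous_comp _ _ _ (fun t : R => 1 - t) (@ln R)).
    by apply: cvgB; [exact: cvg_cst|exact: cvg_id].
  by apply: continuous_ln; lra.
- split.
  + by move=> t; rewrite in_itv/= => /andP[? ?]; have [] := dF t ltac:(lra) ltac:(lra).
  + by apply: cvg_at_right_filter; apply: cF; lra.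
  + by apply: cvg_at_left_filter; apply: cF; lra.
- move=> t; rewrite in_itv/= => /andP[? ?]; rewrite derive1E.
  by have [_ ->] := dF t ltac:(lra) ltac:(lra).
Qed.

Definition logt (t : R) : R := - ln t - ln (1 - t).

Lemma logt_ge0 t : 0 < t < 1 -> 0 <= logt t.
Proof.
move=> /andP[t0 t1]; rewrite /logt.
have : ln t <= 0 by rewrite ln_le0// ltW.
have : ln (1 - t) <= 0 by rewrite ln_le0//; lra.
lra.
Qed.

Lemma measurable_logt (D : set (measurableTypeR R)) : measurable_fun D logt.
Proof.
apply: measurable_funTS; apply: measurable_funB.
  by apply: measurableT_comp => //; exact: measurable_ln.
apply: measurableT_comp; first exact: measurable_ln.
by apply: measurable_funB.
Qed.

(** The value is exactly 2; a lower bound on ]a, 1 - a[ with a small avoids the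
    passage to the limit at the endpoints. *)
Lemma integral_logt_lb (e : R) : 0 < e ->
  ((2 - e)%:E <= \int[unif]_(t in `]0%R, 1%R[) (logt t)%:E)%E.
Proof.
move=> e0; pose b := Num.min (e / 8) (1 / 4); have b0 : 0 < b.
  by rewrite lt_min; apply/andP; split; lra.
have be : b <= e / 8 by rewrite ge_min lexx.
have b4 : b <= 1 / 4 by rewrite ge_min lexx orbT.
(* a is a square so that the error term of [mulr_ln_ge] is explicit. *)
pose a := b ^+ 2; have a0 : 0 < a by rewrite exprn_gt0.
have ab : a <= b by rewrite /a; nra.
have sa : Num.sqrt a = b by rewrite /a sqrtr_sqr gtr0_norm.
have m01 : measurable (`]0, 1[%classic : set (measurableTypeR R)) by [].
rewrite integral_mkcond integral_uniform; last 2 first.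
- apply/(measurable_restrictT _ m01); apply/measurable_EFinP; exact: measurable_logt.
- apply: erestrict_ge0 => t /=; rewrite in_itv/= => t01.
  by rewrite lee_fin logt_ge0.
rewrite subr0 invr1 mul1e.
apply: (@le_trans _ _ (\int[lebesgue_measure]_(t in `[a, (1 - a)%R]) (logt t)%:E)%E).
  rewrite /logt integral_logt_itv//; last lra.
  rewrite lee_fin; have := mulr_ln_ge a0; rewrite sa.
  have : (1 - a) * ln (1 - a) <= 0.
    by rewrite mulr_ge0_le0 ?ln_le0//; lra.
  rewrite mulr2n; lra.
have aI : `[a, (1 - a)%R] `<=` `]0, 1[.
  by move=> t /=; rewrite !in_itv/= => /andP[? ?]; lra.
rewrite [leLHS](_ : _ = (\int[lebesgue_measure]_(t in `[a, (1 - a)%R])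
    ((EFin \o logt) \_ `]0%R, 1%R[) t)%E); last first.
  by apply: eq_integral => t /set_mem /aI ht; rewrite patchE mem_set.
apply: ge0_subset_integral => //.
- apply: measurable_funTS.
  apply/(measurable_restrictT _ m01); apply/measurable_EFinP; exact: measurable_logt.
- move=> t _; apply: erestrict_ge0 => {}t /=; rewrite in_itv/= => t01.
  by rewrite lee_fin logt_ge0.
- by move=> t /=; rewrite !in_itv/= => /andP[? ?]; lra.
Qed.

End LogIntegral.

Lemma measurable_lne {R : realType} : measurable_fun [set: \bar R] (@lne R).
Proof.
apply: (measurability _ (ErealGenCInfty.measurableE R)) => // _ [_ [r ->] <-].
rewrite setTI (_ : _ @^-1` _ = `[(expR r)%:E, +oo[%classic); first exact: emeasurable_itv.
have rE (x : \bar R) : (r%:E <= lne x)%E = ((expR r)%:E <= x)%E.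
  have [x0|x0] := leP 0%E x.
    have xK : expeR (lne x) = x by apply: lneK; rewrite in_itv/= x0 leey.
    by rewrite -[in RHS]xK -[LHS]lee_expeR.
  rewrite (le0_lneNy (ltW x0)). apply/esym/negbTE; rewrite -ltNge.
  by apply: (lt_trans x0); rewrite lte_fin expR_gt0.
by apply/seteqP; split => x /=; rewrite !in_itv/= !andbT rE.
Qed.

Section Entropy.
Context {R : realType}.
Variables (eta : probability (measurableTypeR R) R) (V : R -> \bar R).
Hypothesis hV : is_potential eta V.
Local Notation mu := (@lebesgue_measure R).

Let numu : eta `<< mu.
Proof.
apply/null_content_dominatesP => A mA A0; exact: (eta_dominated hV mA A0).
Qed.

(** The Radon-Nikodym derivative is unique up to a Lebesgue-null set, hence up
    to an eta-null set. *)
Lemma entropyE : entropy eta = (\int[eta]_x (- V x))%E.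
Proof.
have mV : measurable_fun [set: measurableTypeR R] V by exact: (measurable_potential hV).
have H : ae_eq mu setT (Radon_Nikodym (charge_of_finite_measure eta) mu) (fun x => expeR (- V x)).
  apply: integral_ae_eq => //.
  - exact: Radon_Nikodym_integrable.
  - exact: (measurable_expeR_potential hV).
  - by move=> E _ mE; rewrite -(Radon_Nikodym_integral _ mE)//= (proj2 hV).
rewrite /entropy; apply: ae_eq_integral => //.
- apply: measurableT_comp; first exact: measurable_lne.
  exact: measurable_int (Radon_Nikodym_integrable _).
- exact: measurableT_comp.
have [N [mN N0 HN]] := H.
exists N; split => //; first exact: (eta_dominated hV mN N0).
move=> x /= nx; apply: HN => /= hx; apply: nx => _.
by rewrite hx// expeRK.
Qed.

(** The two preimages differ by a subset of a countable set, which is Borel and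
    null. *)
Lemma derive_preimage_mass (A : set R) : measurable A ->
  eta (derive1 (fine \o V) @^-1` A) = eta (slope V @^-1` A).
Proof.
move=> mA; have cV := proj1 hV.
have ms := measurable_slope cV.
have cN := countable_slope_neq cV (idom_nonempty hV).
have md := measurable_fun_countable_neq ms cN.
set N := [set x | _] in cN.
have mN : measurable (N : set (measurableTypeR R)) by exact: measurable_countable.
have N0 := eta_countable hV cN.
have m1 : measurable (derive1 (fine \o V) @^-1` A : set (measurableTypeR R)).
  by rewrite -[X in measurable X]setTI; exact: md.
have m2 : measurable (slope V @^-1` A : set (measurableTypeR R)).
  by rewrite -[X in measurable X]setTI; exact: ms.
have sub (X Y : set (measurableTypeR R)) : measurable X -> measurable Y ->
    X `<=` Y `|` N -> (eta X <= eta Y)%E.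
  move=> mX mY XY; apply: (@le_trans _ _ (eta (Y `|` N))).
    by apply: le_measure; rewrite ?inE//; exact: measurableU.
  by rewrite -[leRHS]adde0 -N0; exact: measureU2.
apply/eqP; rewrite eq_le; apply/andP; split; apply: sub => //.
- move=> x /= Ax; have [xN|/contrapT E] := pselect (N x); first by right.
  by left; rewrite /= -E.
- move=> x /= Ax; have [xN|/contrapT E] := pselect (N x); first by right.
  by left; rewrite /= E.
Qed.

Lemma moment_integral (nu : probability (measurableTypeR R) R) (f : R -> \bar R) :
  is_moment_measure eta V nu -> measurable_fun [set: R] f ->
  (\int[nu]_y f y = \int[eta]_x f (slope V x))%E.
Proof.
move=> hnu mf; apply: integral_law => //; first exact: (measurable_slope (proj1 hV)).
move=> A mA; rewrite (_ : _ A = nu A)// hnu// /pushforward.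
exact: derive_preimage_mass.
Qed.

Lemma moment_measure_exists :
  exists nu : probability (measurableTypeR R) R, is_moment_measure eta V nu.
Proof.
have ms : measurable_fun [set: measurableTypeR R] (slope V : _ -> measurableTypeR R).
  exact: (measurable_slope (proj1 hV)).
pose mixin := isMeasurableFun.Build _ _ _ _ _ ms.
pose S : {mfun measurableTypeR R >-> measurableTypeR R} := HB.pack (slope V) mixin.
exists (distribution eta S) => A mA.
by rewrite /pushforward derive_preimage_mass.
Qed.

Lemma integral_potential (f : R -> \bar R) : measurable_fun [set: R] f ->
  (forall x, 0 <= f x)%E ->
  (\int[eta]_x f x = \int[mu]_x (f x * expeR (- V x)))%E.
Proof.
move=> mf f0.
have mg : measurable_fun [set: measurableTypeR R] (fun x => expeR (- V x)).
  exact: (measurable_expeR_potential hV).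
rewrite -(@Radon_Nikodym_SigmaFinite.change_of_variables _ _ _ eta mu numu _ setT)//.
have iRN := Radon_Nikodym_SigmaFinite.f_integrable numu.
apply: ge0_ae_eq_integral => //.
- by apply: emeasurable_funM => //; exact: measurable_int iRN.
- exact: emeasurable_funM.
- by move=> x _; rewrite mule_ge0// Radon_Nikodym_SigmaFinite.f_ge0.
- by move=> x _; rewrite mule_ge0// expeR_ge0.
apply: ae_eqe_mul2l; apply: integral_ae_eq => //.
by move=> E _ mE; rewrite -(Radon_Nikodym_SigmaFinite.f_integral numu mE); exact: (proj2 hV).
Qed.

End Entropy.

(** * The entropy-transport inequality *)

Section MainInequality.
Context {R : realType}.
Local Notation borelR := (measurableTypeR R).
Local Notation unif := (uniform_prob (@ltr01 R)).

Section OneMeasure.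
Variables (eta nu : probability borelR R) (V : R -> \bar R).
Hypothesis hV : is_potential eta V.
Hypothesis ec : essentially_continuous eta V.
Hypothesis hnu : is_moment_measure eta V nu.

Let cV : convex_lsc V := proj1 hV.

(** The potential as a function of the level t; real-valued, since quantiles
    lie in the domain, and set to 0 outside ]0, 1[. *)
Definition qpot : R -> R := (rpot V \o quant eta) \_ `]0, 1[.

Lemma qpotE t : 0 < t < 1 -> qpot t = rpot V (quant eta t).
Proof. by move=> t01; rewrite /qpot patchE mem_set//= in_itv/=. Qed.

Lemma measurable_qpot : measurable_fun [set: borelR] qpot.
Proof.
have m01 : measurable (`]0, 1[%classic : set borelR) by [].
apply/(measurable_restrictT _ m01); apply: measurable_funTS.
apply: measurableT_comp; last exact: (measurable_quant hV ec).
by apply: measurableT_comp => //; exact: (measurable_potential hV).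
Qed.

Lemma entropy_qpot : entropy eta = (\int[unif]_t (- qpot t)%:E)%E.
Proof.
rewrite (entropyE hV) (integral_quant hV ec); last first.
  by apply: measurableT_comp => //; exact: (measurable_potential hV).
apply: ae_eq_integral => //.
- apply: measurableT_comp => //; apply: measurableT_comp.
    exact: (measurable_potential hV).
  exact: (measurable_quant hV ec).
- apply/measurable_EFinP; apply: measurableT_comp => //; exact: measurable_qpot.
exists (~` `]0, 1[%classic); split.
- exact: measurableC.
- exact: uniform_out01.
- move=> t /= nt; apply: contra_not nt => /=; rewrite in_itv/= => t01 _.
  rewrite qpotE// EFinN; congr (- _)%E.
  by apply: (potential_fin cV); exact: (idom_fin cV (quant_idom hV ec t01)).
Qed.

Lemma qpot_bounded_below : exists c, forall t, - qpot t <= c.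
Proof.
have [C C0 HC] := dens_bounded hV ec; exists (`|ln C|) => t.
rewrite /qpot patchE; case: ifPn => [/set_mem|]; last by rewrite oppr0.
rewrite /= in_itv/= => t01; have := HC _ (quant_idom hV ec t01).
rewrite /dens -[X in _ <= X -> _]lnK ?posrE// ler_expR => h.
exact: (le_trans h (ler_norm _)).
Qed.

Variable f : R -> \bar R.
Hypothesis mf : measurable_fun [set: R] f.
Variable C : R.
Hypothesis fC : forall y, ((- (C * (1 + `|y|)))%:E <= f y)%E.

Let mfs : measurable_fun [set: borelR] (f \o slope V).
Proof. by apply: measurableT_comp => //; exact: (measurable_slope cV). Qed.

Lemma moment_integral_gtNy : (-oo < \int[nu]_y f y)%E.
Proof.
rewrite (moment_integral hV hnu mf).
apply: (@integral_gtNy_of_minorant _ borelR R eta (f \o slope V) (EFin \o (fun x => C * (1 + `|slope V x|)))) => //; last first.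
  by move=> x /=; exact: fC.
have i1 : eta.-integrable setT (EFin \o (fun x => `|slope V x|)).
  exact: (integrable_norm (slope_integrable hV)).
have ic : eta.-integrable setT (EFin \o cst 1) by exact: finite_measure_integrable_cst.
have := integrableZl measurableT C (integrableD measurableT ic i1).
by apply: eq_integrable.
Qed.

Lemma moment_integrable : (\int[nu]_y f y < +oo)%E ->
  eta.-integrable setT (f \o slope V).
Proof.
move=> fy; apply: integrable_of_fin_num => //.
rewrite /= -(moment_integral hV hnu mf) fin_numE.
by rewrite gt_eqF ?moment_integral_gtNy//= lt_eqF.
Qed.

End OneMeasure.

Section TwoMeasures.
Variables (eta1 eta2 nu1 nu2 : probability borelR R) (V1 V2 : R -> \bar R).
Hypotheses (hV1 : is_potential eta1 V1) (hV2 : is_potential eta2 V2).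
Hypotheses (ec1 : essentially_continuous eta1 V1)
           (ec2 : essentially_continuous eta2 V2).
Hypotheses (hnu1 : is_moment_measure eta1 V1 nu1)
           (hnu2 : is_moment_measure eta2 V2 nu2).
Variable f : R -> \bar R.
Hypothesis hf : proper_convex_lsc f.

Let fN x : (-oo < f x)%E. Proof. by case: hf => -[]. Qed.
Let mf : measurable_fun [set: R] f.
Proof. by apply: lower_semicontinuous_measurable; case: hf => -[]. Qed.
Let mfs : measurable_fun [set: R] (fenchel f).
Proof. by apply: lower_semicontinuous_measurable; exact: fenchel_lsc. Qed.

Let k1 := (\int[nu1]_y f y)%E.
Let k2 := (\int[nu2]_y fenchel f y)%E.

(** The key inequality: [young_block] on the left and on the right of the two
    quantiles of level t, with the integrals of the slopes bounded by
    [slope_block_left] and [slope_block_right]. *)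
Lemma transport_cost_lb (t : R) : (k1 < +oo)%E -> (k2 < +oo)%E -> 0 < t < 1 ->
  dens V1 (quant eta1 t) * dens V2 (quant eta2 t) <=
  t * (1 - t) * (fine k1 + fine k2).
Proof.
move=> k1y k2y t01; have /andP[t0 t1] := t01.
have [C1 HC1] := convex_minorant hf.1 hf.2.
have [C2 HC2] := fenchel_minorant fN hf.2.
have i1 := moment_integrable hV1 hnu1 mf HC1 k1y.
have i2 := moment_integrable hV2 hnu2 mfs HC2 k2y.
have s1 := slope_integrable hV1; have s2 := slope_integrable hV2.
set x1 := quant eta1 t; set x2 := quant eta2 t.
have d1 : idom V1 x1 by exact: (quant_idom hV1 ec1 t01).
have d2 : idom V2 x2 by exact: (quant_idom hV2 ec2 t01).
have psiN b : (-oo < fenchel f b)%E.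
  by apply: lt_le_trans (HC2 b); exact: ltNyr.
have Young a b : ((a * b)%:E <= f a + fenchel f b)%E.
  by apply: young_fenchel => //; case: hf.
have mL x : measurable (`]-oo, x]%classic : set borelR) by [].
have mR x : measurable (`]x, +oo[%classic : set borelR) by [].
have split (P : probability borelR R) x (g : R -> \bar R) : P.-integrable setT g ->
    fine (\int[P]_y g y) = fine (\int[P]_(y in `]-oo, x]) g y) + fine (\int[P]_(y in `]x, +oo[) g y).
  move=> ig; rewrite -fineD; last 2 first.
  - by apply: integrable_fin_num => //; exact: integrableS ig.
  - by apply: integrable_fin_num => //; exact: integrableS ig.
  rewrite -integral_setU//.
  - by rewrite -itv_bndbnd_setU// set_itvE.
  - by apply: measurable_funTS; exact: measurable_int ig.
  - apply/disj_setPS => z [/=]; rewrite !in_itv/= andbT => zx xz.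
    by rewrite ltNge zx in xz.
have q1 : cumul eta1 x1 = t := cumul_quant hV1 ec1 t01.
have q2 : cumul eta2 x2 = t := cumul_quant hV2 ec2 t01.
have PL1 : eta1 `]-oo, x1]%classic = t%:E.
  by rewrite -[LHS]fineK ?fin_num_measure// -/(cumul eta1 x1) q1.
have PL2 : eta2 `]-oo, x2]%classic = t%:E.
  by rewrite -[LHS]fineK ?fin_num_measure// -/(cumul eta2 x2) q2.
have PR1 : eta1 `]x1, +oo[%classic = (1 - t)%:E.
  by rewrite -[LHS]fineK ?fin_num_measure// cumul_right q1.
have PR2 : eta2 `]x2, +oo[%classic = (1 - t)%:E.
  by rewrite -[LHS]fineK ?fin_num_measure// cumul_right q2.
have YL := young_block (mL x1) (mL x2) t0 PL1 PL2
  (integrableS measurableT (mL x1) (@subsetT _ _) s1)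
  (integrableS measurableT (mL x2) (@subsetT _ _) s2)
  (integrableS measurableT (mL x1) (@subsetT _ _) i1)
  (integrableS measurableT (mL x2) (@subsetT _ _) i2) psiN Young.
have YR := young_block (mR x1) (mR x2) (ltac:(lra) : 0 < 1 - t) PR1 PR2
  (integrableS measurableT (mR x1) (@subsetT _ _) s1)
  (integrableS measurableT (mR x2) (@subsetT _ _) s2)
  (integrableS measurableT (mR x1) (@subsetT _ _) i1)
  (integrableS measurableT (mR x2) (@subsetT _ _) i2) psiN Young.
have bL1 := slope_block_left hV1 ec1 d1; have bL2 := slope_block_left hV2 ec2 d2.
have bR1 := slope_block_right hV1 ec1 d1; have bR2 := slope_block_right hV2 ec2 d2.
have g1 := dens_gt0 V1 x1; have g2 := dens_gt0 V2 x2.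
rewrite /k1 (moment_integral hV1 hnu1 mf) (split _ x1 _ i1).
rewrite /k2 (moment_integral hV2 hnu2 mfs) (split _ x2 _ i2).
move: YL YR bL1 bL2 bR1 bR2 g1 g2 => /=.
set aL1 := (\int[eta1]_(x in _) slope V1 x)%R.
set aL2 := (\int[eta2]_(x in _) slope V2 x)%R.
set aR1 := (\int[eta1]_(x in `]x1, +oo[) slope V1 x)%R.
set aR2 := (\int[eta2]_(x in `]x2, +oo[) slope V2 x)%R.
set fL1 := fine _; set fL2 := fine _; set fR1 := fine _; set fR2 := fine _.
set y1 := dens V1 x1; set y2 := dens V2 x2.
move=> YL YR bL1 bL2 bR1 bR2 g1 g2.
have hL : y1 * y2 <= t * (fL1 + fL2).
  apply: le_trans YL; rewrite -[leRHS]mulrNN ler_pM//; lra.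
have hR : y1 * y2 <= (1 - t) * (fR1 + fR2).
  by apply: le_trans YR; rewrite ler_pM//; lra.
have h1 := ler_wpM2l (ltac:(lra) : 0 <= 1 - t) hL.
have h2 := ler_wpM2l (ltW t0) hR.
nra.
Qed.

(** Integrate the logarithm of [transport_cost_lb] over ]0, 1[ and apply
    ln K <= K - 1.  An infinite cost or an entropy -oo makes the inequality
    trivial, and entropies are never +oo since densities are bounded. *)
Lemma entropy_transport :
  (entropy eta1 + entropy eta2 <= (- 3)%:E + (k1 + k2))%E.
Proof.
have [C1 HC1] := convex_minorant hf.1 hf.2.
have [C2 HC2] := fenchel_minorant fN hf.2.
have k1N := moment_integral_gtNy hV1 hnu1 mf HC1.
have k2N := moment_integral_gtNy hV2 hnu2 mfs HC2.
have [k1y|] := ltP k1 +oo%E; last first.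
  by rewrite leye_eq => /eqP ->; rewrite addye ?gt_eqF// addey// leey.
have [k2y|] := ltP k2 +oo%E; last first.
  by rewrite leye_eq => /eqP ->; rewrite addey ?gt_eqF// addey// leey.
have fk1 : k1 = (fine k1)%:E by rewrite fineK// fin_numE gt_eqF//= lt_eqF.
have fk2 : k2 = (fine k2)%:E by rewrite fineK// fin_numE gt_eqF//= lt_eqF.
have lb t := transport_cost_lb k1y k2y (t := t).
rewrite fk1 fk2 -!EFinD; set K := fine k1 + fine k2 in lb *.
have K0 : 0 < K.
  have := lb (1 / 2) ltac:(lra).
  have := mulr_gt0 (dens_gt0 V1 (quant eta1 (1 / 2))) (dens_gt0 V2 (quant eta2 (1 / 2))).
  lra.
rewrite (entropy_qpot hV1 ec1) (entropy_qpot hV2 ec2).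
have [c1 Hc1] := qpot_bounded_below hV1 ec1.
have [c2 Hc2] := qpot_bounded_below hV2 ec2.
have mq1 := measurable_qpot hV1 ec1; have mq2 := measurable_qpot hV2 ec2.
have mn1 : measurable_fun [set: borelR] (fun t => - qpot eta1 V1 t).
  by apply: measurableT_comp => //; exact: mq1.
have mn2 : measurable_fun [set: borelR] (fun t => - qpot eta2 V2 t).
  by apply: measurableT_comp => //; exact: mq2.
have [j1|->] := @bounded_above_integral _ _ _ unif (fun t => - qpot eta1 V1 t) c1
  mn1 Hc1; last by rewrite leNye.
have [j2|->] := @bounded_above_integral _ _ _ unif (fun t => - qpot eta2 V2 t) c2
  mn2 Hc2; last by rewrite addeNy leNye.
have jK : unif.-integrable setT (EFin \o cst (ln K)) by exact: finite_measure_integrable_cst.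
set h1 := (\int[unif]_t (- qpot eta1 V1 t)%:E)%E.
set h2 := (\int[unif]_t (- qpot eta2 V2 t)%:E)%E.
have fh1 : h1 = (fine h1)%:E by rewrite fineK//; exact: (integrable_fin_num measurableT j1).
have fh2 : h2 = (fine h2)%:E by rewrite fineK//; exact: (integrable_fin_num measurableT j2).
rewrite fh1 fh2 -EFinD lee_fin.
have main : 2 <= ln K - fine h1 - fine h2.
  apply/ler_addgt0Pr => e e0; rewrite -lerBlDr -lee_fin.
  apply: (le_trans (integral_logt_lb e0)).
  pose g t := ln K - (- qpot eta1 V1 t) - (- qpot eta2 V2 t).
  have jg : unif.-integrable setT (EFin \o g).
    have := integrableB measurableT (integrableB measurableT jK j1) j2.
    by apply: eq_integrable.
  have -> : (ln K - fine h1 - fine h2)%:E = (\int[unif]_t (g t)%:E)%E.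
    rewrite -[RHS]fineK; last exact: (integrable_fin_num measurableT jg).
    congr EFin; rewrite -/(Rintegral unif setT g) /g.
    rewrite RintegralB//; last first.
      by have := integrableB measurableT jK j1; apply: eq_integrable.
    have uT : unif [set: borelR] = 1%E by exact: probability_setT.
    rewrite RintegralB// Rintegral_cst// [X in ln K * fine X]uT/= mulr1.
    by [].
  rewrite integral_mkcond.
  have m01 : measurable (`]0, 1[%classic : set borelR) by [].
  have logt_le_g t : 0 < t < 1 -> logt t <= g t.
    move=> t01; have := lb t t01; have /andP[t0 t1] := t01.
    rewrite -ler_ln ?posrE ?mulr_gt0 ?dens_gt0//; last lra.
    rewrite !lnM ?posrE ?dens_gt0 ?mulr_gt0//; try lra.
    rewrite /dens !expRK /logt /g !qpotE//; lra.
  rewrite -[leRHS](_ : (\int[unif]_t ((EFin \o g) \_ `]0%R, 1%R[) t)%E = _).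
  apply: ge0_le_integral => //.
  - move=> t _; apply: erestrict_ge0 => {}t /=; rewrite in_itv/= => t01.
    by rewrite lee_fin logt_ge0.
  - apply/(measurable_restrictT _ m01); apply/measurable_EFinP; exact: measurable_logt.
  - apply/(measurable_restrictT _ m01); apply: measurable_funTS; exact: measurable_int jg.
  - move=> t _; rewrite !patchE; case: ifPn => // /set_mem /=; rewrite in_itv/= => t01.
    by rewrite lee_fin logt_le_g.
  apply: ae_eq_integral => //.
  - apply/(measurable_restrictT _ m01); apply: measurable_funTS; exact: measurable_int jg.
  - exact: measurable_int jg.
  - exists (~` `]0, 1[%classic); split.
    + exact: measurableC.
    + exact: uniform_out01.
    + move=> t /= nt; apply: contra_not nt => /= t01 _.
      by rewrite patchE mem_set.
have := @le_ln1Dx R (K - 1) ltac:(lra); rewrite addrC subrK.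
lra.
Qed.

End TwoMeasures.

Theorem ET1_expR1 : ET1 (expR 1 : R).
Proof.
move=> eta1 eta2 nu1 nu2 [V1 [hV1 ec1 hnu1]] [V2 [hV2 ec2 hnu2]].
rewrite /ET_ineq.
have -> : - ln (expR 1 * expR 1 ^+ 2) = - 3 :> R.
  by rewrite -expRM_natl -expRD expRK; lra.
rewrite -leeBlDl// ; apply: le_ereal_inf_tmp => _ [f hf <-].
rewrite leeBlDl//.
exact: entropy_transport hV1 hV2 ec1 ec2 hnu1 hnu2 _ hf.
Qed.

End MainInequality.

(** * Asymmetric Laplace measures *)

Section Laplace.
Context {R : realType}.
Local Notation borelR := (measurableTypeR R).
Local Notation mu := (@lebesgue_measure R).

Definition vee (a b x : R) : R := Num.max (- a * x) (b * x).

Lemma vee_left a b x : 0 < a -> 0 < b -> x <= 0 -> vee a b x = - a * x.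
Proof. by move=> a0 b0 x0; rewrite /vee max_l//; nra. Qed.

Lemma vee_right a b x : 0 < a -> 0 < b -> 0 <= x -> vee a b x = b * x.
Proof. by move=> a0 b0 x0; rewrite /vee max_r//; nra. Qed.

Lemma vee_continuous a b : continuous (vee a b).
Proof.
move=> x; apply: continuous_max.
  by apply: cvgMr; exact: cvg_id.
by apply: cvgMr; exact: cvg_id.
Qed.

Lemma measurable_vee a b : measurable_fun [set: R] (vee a b).
Proof. by apply: continuous_measurable_fun; exact: vee_continuous. Qed.

Lemma vee_shift_convex_lsc a b k : convex_lsc (fun x => (vee a b (x + k))%:E).
Proof.
split => [x|t x y /andP[t0 t1]|].
- exact: ltNyr.
- rewrite -!EFinM -EFinD lee_fin /vee ge_max.
  have h1 z : - a * z <= vee a b z by rewrite /vee le_max lexx.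
  have h2 z : b * z <= vee a b z by rewrite /vee le_max lexx orbT.
  have p1 z := ler_wpM2l t0 (h1 z); have p2 z := ler_wpM2l t0 (h2 z).
  have t1' : 0 <= 1 - t by lra.
  have q1 z := ler_wpM2l t1' (h1 z); have q2 z := ler_wpM2l t1' (h2 z).
  rewrite -/(vee a b (x + k)) -/(vee a b (y + k)).
  apply/andP; split.
  + apply: le_trans (lerD (p1 (x + k)) (q1 (y + k))); lra.
  + apply: le_trans (lerD (p2 (x + k)) (q2 (y + k))); lra.
- move=> x r; rewrite lte_fin => rx.
  exists [set y | r < vee a b (y + k)] => //.
  have : {for x, continuous (fun y => vee a b (y + k))}.
    apply: (@continuous_comp _ _ _ (fun y : R => y + k) (vee a b)).
      by apply: cvgD; [exact: cvg_id|exact: cvg_cst].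
    exact: vee_continuous.
  by move=> /cvgr_gt; apply.
Qed.

Lemma integral_expR_right b : 0 < b ->
  (\int[mu]_(x in `[0%R, +oo[) (expR (- (b * x)))%:E = (b^-1)%:E)%E.
Proof.
move=> b0; have := integral_exponential_pdf b0.
rewrite (_ : (fun x => _) = (fun x => (b * expR (- (b * x)))%:E) \_ `[0%R, +oo[); last first.
  apply/funext => x; rewrite /exponential_pdf !patchE; case: ifPn => // _.
  by rewrite mulNr.
rewrite -integral_mkcond.
under eq_integral do rewrite EFinM.
rewrite ge0_integralZl_EFin//; last 2 first.
- apply/measurable_EFinP; apply: measurableT_comp => //.
  by apply: measurableT_comp => //; exact: mulrl_measurable.
- exact: ltW.
set J := (\int[mu]_(x in _) _)%E => H.
have : (b^-1%:E * (b%:E * J) = b^-1%:E)%E by rewrite H mule1.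
by rewrite muleA -EFinM mulVf ?gt_eqF// mul1e.
Qed.

Lemma integral_expR_left a : 0 < a ->
  (\int[mu]_(x in `]-oo, 0%R]) (expR (a * x))%:E = (a^-1)%:E)%E.
Proof.
move=> a0; rewrite -(integral_expR_right a0) ge0_integration_by_substitution0//.
- by apply: eq_integral => x _; rewrite mulrN opprK.
- apply/measurable_EFinP; apply: measurableT_comp => //.
  by apply: measurableT_comp => //; exact: mulrl_measurable.
Qed.

Lemma measurable_expR_vee a b (D : set borelR) :
  measurable_fun D (fun x => (expR (- vee a b x))%:E).
Proof.
apply: measurable_funTS; apply/measurable_EFinP; apply: measurableT_comp => //.
by apply: measurableT_comp => //; exact: measurable_vee.
Qed.

Lemma integral_vee_right a b : 0 < a -> 0 < b ->
  (\int[mu]_(x in `[0%R, +oo[) (expR (- vee a b x))%:E = (b^-1)%:E)%E.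
Proof.
move=> a0 b0; rewrite -(integral_expR_right b0); apply: eq_integral => x.
by rewrite inE/= in_itv/= andbT => x0; rewrite vee_right.
Qed.

Lemma integral_vee_left a b : 0 < a -> 0 < b ->
  (\int[mu]_(x in `]-oo, 0%R[) (expR (- vee a b x))%:E = (a^-1)%:E)%E.
Proof.
move=> a0 b0; rewrite integral_itv_bndo_bndc; last exact: measurable_expR_vee.
rewrite -(integral_expR_left a0); apply: eq_integral => x.
by rewrite inE/= in_itv/= => x0; rewrite vee_left// mulNr opprK.
Qed.

Lemma integral_vee a b : 0 < a -> 0 < b ->
  (\int[mu]_x (expR (- vee a b x))%:E = (a^-1 + b^-1)%:E)%E.
Proof.
move=> a0 b0.
have -> : [set: R] = `]-oo, 0[ `|` `[0, +oo[ :> set borelR.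
  by rewrite -itv_bndbnd_setU// set_itvE.
rewrite ge0_integral_setU//.
- by rewrite integral_vee_left// integral_vee_right.
- exact: measurable_expR_vee.
- apply/disj_setPS => z [/=]; rewrite !in_itv/= andbT => z0.
  by rewrite leNgt z0.
Qed.

Definition laplace (a b : R) (ab : [/\ 0 < a, 0 < b & a^-1 + b^-1 = 1])
  (A : set borelR) : \bar R :=
  (\int[mu]_(x in A) (expR (- vee a b x))%:E)%E.

Section LaplaceMeasure.
Variables (a b : R) (ab : [/\ 0 < a, 0 < b & a^-1 + b^-1 = 1]).
Local Notation lap := (laplace ab).

Let lap0 : lap set0 = 0%E.
Proof. by rewrite /laplace integral_set0. Qed.

Let lap_ge0 A : (0 <= lap A)%E.
Proof. by apply: integral_ge0 => x _; rewrite lee_fin expR_ge0. Qed.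

Let lap_sigma_additive : semi_sigma_additive lap.
Proof.
move=> /= F mF tF mUF; rewrite /laplace; apply: cvg_toP.
  apply: ereal_nondecreasing_is_cvgn => m n mn.
  apply: lee_sum_nneg_natr => // k _ _; apply: integral_ge0 => /= x Fkx.
  by rewrite lee_fin expR_ge0.
rewrite ge0_integral_bigcup//=.
- exact: measurable_expR_vee.
Qed.

HB.instance Definition _ := isMeasure.Build _ _ _ lap lap0 lap_ge0
  lap_sigma_additive.

Let lap_setT : lap [set: borelR] = 1%E.
Proof. by case: (ab) => a0 b0 e; rewrite /laplace integral_vee// e. Qed.

HB.instance Definition _ := @Measure_isProbability.Build _ _ R lap lap_setT.

Let P : probability borelR R := lap.
Let V x : \bar R := (vee a b x)%:E.

Lemma laplace_potential : is_potential P V.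
Proof.
split; last by [].
have := vee_shift_convex_lsc a b 0.
by under eq_fun do rewrite addr0.
Qed.

Lemma laplace_idom x : idom V x.
Proof. by exists (x - 1), (x + 1); split; rewrite ?ltry//; lra. Qed.

Lemma laplace_ec : essentially_continuous P V.
Proof.
move=> x [_ nx]; exfalso; apply: nx.
have -> : msupport P = setT.
  apply/seteqP; split => // y _.
  by apply: (idom_in_support laplace_potential); exact: laplace_idom.
by rewrite interiorT.
Qed.

Lemma laplace_slope_left x : x < 0 -> slope V x = - a.
Proof.
have [a0 b0 _] := ab; move=> x0; rewrite slopeE; last exact: laplace_idom.
have H y z : y < z -> z < 0 -> rslope V y <= - a <= rslope V z.
  move=> yz z0.
  have := rslope_bounds (proj1 laplace_potential) (laplace_idom y) (laplace_idom z) yz.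
  rewrite /rpot /= (vee_left a0 b0 (ltW (lt_trans yz z0))) (vee_left a0 b0 (ltW z0)).
  have -> : - a * z - - a * y = - a * (z - y) by ring.
  by rewrite !ler_pM2r ?subr_gt0.
have /andP[h1 _] := H x (x / 2) ltac:(lra) ltac:(lra).
have /andP[_ h2] := H (x * 2) x ltac:(lra) x0.
by apply/eqP; rewrite eq_le h1.
Qed.

(** At 0 this is the right derivative, for which every difference quotient
    equals b. *)
Lemma laplace_slope_right x : 0 <= x -> slope V x = b.
Proof.
have [a0 b0 _] := ab; move=> x0; rewrite slopeE; last exact: laplace_idom.
rewrite /rslope (_ : [set _ | _ in _] = [set b]) ?inf1//.
have E w : x < w -> (rpot V w - rpot V x) / (w - x) = b.
  move=> xw; rewrite /rpot /= !vee_right//; last by lra.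
  by field; rewrite subr_eq0 gt_eqF.
apply/seteqP; split.
- by move=> _ [w [_ xw] <-] /=; rewrite E.
- move=> _ ->; exists (x + 1); last by rewrite E//; lra.
  by split; [exact: laplace_idom|lra].
Qed.

Lemma laplace_moment_integral (nu : probability borelR R) (f : R -> \bar R) r1 r2 :
  is_moment_measure P V nu -> measurable_fun [set: R] f ->
  f (- a) = r1%:E -> f b = r2%:E ->
  (\int[nu]_y f y = (r1 / a + r2 / b)%:E)%E.
Proof.
have [a0 b0 _] := ab.
move=> hnu mf f1 f2; rewrite (moment_integral laplace_potential hnu mf).
have -> : [set: borelR] = `]-oo, 0[ `|` `[0, +oo[.
  by rewrite -itv_bndbnd_setU// set_itvE.
rewrite integral_setU//; last 2 first.
- apply: measurable_funTS; apply: measurableT_comp => //.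
  exact: (measurable_slope (proj1 laplace_potential)).
- apply/disj_setPS => z [/=]; rewrite !in_itv/= andbT => z0.
  by rewrite leNgt z0.
rewrite (eq_integral (cst r1%:E)); last first.
  by move=> x; rewrite inE/= in_itv/= => x0; rewrite laplace_slope_left.
rewrite [X in (_ + X)%E](eq_integral (cst r2%:E)); last first.
  by move=> x; rewrite inE/= in_itv/= andbT => x0; rewrite laplace_slope_right.
rewrite !integral_cst//= /laplace integral_vee_left// integral_vee_right//.
Qed.

(** The entropy is - 1, and bounds arbitrarily close to it suffice: from
    V <= (exp (d V) - 1) / d one gets int V deta <= 1 / (1 - d), because
    exp (- (1 - d) V) is again of the same form and integrates to
    1 / (1 - d). *)
Lemma laplace_entropy (d : R) : 0 < d < 1 ->
  ((- (1 - d)^-1)%:E <= entropy P)%E.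
Proof.
have [a0 b0 e1] := ab; move=> /andP[d0 d1].
have v0 x : 0 <= vee a b x.
  by have [x0|/ltW x0] := leP 0 x; [rewrite vee_right//|rewrite vee_left//]; nra.
rewrite (entropyE laplace_potential) integral_ge0N; last by move=> x _; rewrite lee_fin.
rewrite EFinN leeN2.
have mv : measurable_fun [set: borelR] V.
  by apply/measurable_EFinP; exact: measurable_vee.
have H : (\int[P]_x (V x + (d^-1)%:E) <= (d^-1 / (1 - d))%:E)%E.
  rewrite (integral_potential laplace_potential); last 2 first.
  - by apply: emeasurable_funD.
  - by move=> x; rewrite -EFinD lee_fin addr_ge0// invr_ge0 ltW.
  have d1' : 0 < 1 - d by lra.
  have c0 : 0 < (1 - d) * a by rewrite mulr_gt0.
  have c1 : 0 < (1 - d) * b by rewrite mulr_gt0.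
  apply: (@le_trans _ _ (\int[mu]_x ((d^-1)%:E * (expR (- vee ((1 - d) * a) ((1 - d) * b) x))%:E))%E).
    apply: ge0_le_integral => //.
    - by move=> x _ /=; rewrite -EFinD -EFinM lee_fin mulr_ge0 ?expR_ge0// addr_ge0// invr_ge0 ltW.
    - apply: emeasurable_funM; first exact: emeasurable_funD.
      exact: measurable_expR_vee.
    - by apply: emeasurable_funM => //; exact: measurable_expR_vee.
    move=> x _ /=; rewrite -EFinD -!EFinM lee_fin.
    have -> : vee ((1 - d) * a) ((1 - d) * b) x = (1 - d) * vee a b x.
      by have [x0|/ltW x0] := leP 0 x; [rewrite !vee_right//|rewrite !vee_left//]; ring.
    have -> : - ((1 - d) * vee a b x) = d * vee a b x - vee a b x by ring.
    rewrite expRD mulrA ler_pM2r ?expR_gt0//.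
    rewrite mulrC ler_pdivlMr// mulrDl mulVf ?gt_eqF// mulrC addrC.
    exact: expR_ge1Dx.
  rewrite ge0_integralZl_EFin//; last 2 first.
  - exact: measurable_expR_vee.
  - by rewrite invr_ge0 ltW.
  rewrite integral_vee// -EFinM lee_fin !invfM -mulrDr e1 mulr1.
  by [].
rewrite ge0_integralD// in H; last 2 first.
- by move=> x _; rewrite lee_fin.
- by move=> x _; rewrite lee_fin invr_ge0 ltW.
have uT : P [set: borelR] = 1%E by exact: probability_setT.
rewrite integral_cst// [X in (_ + _ * X)%E]uT mule1 in H.
move: H; rewrite -leeBrDr// => /le_trans; apply.
rewrite -EFinB lee_fin.
have -> : d^-1 / (1 - d) - d^-1 = (1 - d)^-1 by field; rewrite !gt_eqF//; lra.
exact: lexx.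
Qed.

End LaplaceMeasure.
End Laplace.

(** * Sharpness of the constant *)

Section Sharpness.
Context {R : realType}.
Local Notation borelR := (measurableTypeR R).

(** b is a subgradient of f at x0. *)
Lemma fenchel_affine_extreme (f : R -> \bar R) (x0 b r : R) :
  f x0 = r%:E -> (forall x, ((b * (x - x0) + r)%:E <= f x)%E) ->
  fenchel f b = (x0 * b - r)%:E.
Proof.
move=> fx0 fb; apply/eqP; rewrite eq_le; apply/andP; split.
  apply: ge_ereal_sup => _ [x _ <-]; have := fb x.
  case: (f x) => [s| |] //=; last by rewrite leNye.
  by rewrite -EFinB !lee_fin; lra.
by apply: ereal_sup_ubound; exists x0; rewrite // fx0 EFinB.
Qed.

(** The test function has a kink at the atom - a of nu1, whose subdifferential
    contains both atoms - b and a of nu2, and it has slope a at the other atom b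
    of nu1: it is optimal for the monotone coupling. *)
Lemma transport_laplace_le (a b : R) (ab : [/\ 0 < a, 0 < b & a^-1 + b^-1 = 1])
    (ba : [/\ 0 < b, 0 < a & b^-1 + a^-1 = 1]) (nu1 nu2 : probability borelR R) :
  is_moment_measure (laplace ab) (fun x => (vee a b x)%:E) nu1 ->
  is_moment_measure (laplace ba) (fun x => (vee b a x)%:E) nu2 ->
  (transport nu1 nu2 <= (a ^+ 2)%:E)%E.
Proof.
have [a0 b0 e] := ab; move=> h1 h2.
pose f (x : R) : \bar R := (vee b a (x + a))%:E.
have cf : convex_lsc f by exact: vee_shift_convex_lsc.
have fN x : (-oo < f x)%E by exact: ltNyr.
have fa : f (- a) = 0%:E by rewrite /f addNr vee_right// mulr0.
have fb : f b = (a * (b + a))%:E by rewrite /f vee_right// addr_ge0// ltW.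
have f1 x : ((- b * (x - - a) + 0)%:E <= f x)%E.
  by rewrite /f opprK addr0 lee_fin /vee le_max lexx.
have f2 x : ((a * (x - - a) + 0)%:E <= f x)%E.
  by rewrite /f opprK addr0 lee_fin /vee le_max lexx orbT.
have g1 := fenchel_affine_extreme fa f1.
have g2 := fenchel_affine_extreme fa f2.
apply: (@le_trans _ _ (\int[nu1]_x f x + \int[nu2]_y fenchel f y)%E).
  apply: ereal_inf_lbound; exists f => //.
  by split => //; exists 0; exact: ltry.
rewrite (laplace_moment_integral h1 _ fa fb); last first.
  by apply: lower_semicontinuous_measurable; case: cf.
rewrite (laplace_moment_integral h2 _ g1 g2); last first.
  by apply: lower_semicontinuous_measurable; exact: fenchel_lsc.
rewrite -EFinD lee_fin le_eqVlt; apply/orP; left; apply/eqP.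
have -> : 0 / a + a * (b + a) / b + ((- a * - b - 0) / b + (- a * a - 0) / a) =
  a ^+ 2 * (a^-1 + b^-1) by field; rewrite !gt_eqF.
by rewrite e mulr1.
Qed.

Lemma ET_ineq_fails (c : R) : expR 1 < c ->
  exists eta1 eta2 nu1 nu2 : probability borelR R,
    [/\ log_concave_ec eta1 nu1, log_concave_ec eta2 nu2
      & ~ ET_ineq c eta1 eta2 nu1 nu2].
Proof.
move=> ec; have c0 : 0 < c by apply: lt_trans ec; exact: expR_gt0.
have L1 : 1 < ln c by rewrite -ltr_expR lnK ?posrE.
(* 2 / (1 - k) + a ^ 2 <= 3 + 10 k has to stay below 2 + ln c. *)
pose k := Num.min ((ln c - 1) / 16) (1 / 4).
have k0 : 0 < k by rewrite lt_min; apply/andP; split; lra.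
have k1 : k <= (ln c - 1) / 16 by rewrite ge_min lexx.
have k2 : k <= 1 / 4 by rewrite ge_min lexx orbT.
pose a := (1 - k)^-1; pose b := k^-1.
have a0 : 0 < a by rewrite invr_gt0; lra.
have b0 : 0 < b by rewrite invr_gt0.
have ab : [/\ 0 < a, 0 < b & a^-1 + b^-1 = 1] by split => //; rewrite !invrK subrK.
have ba : [/\ 0 < b, 0 < a & b^-1 + a^-1 = 1] by split => //; rewrite !invrK addrC subrK.
have P1 := laplace_potential ab; have P2 := laplace_potential ba.
have [nu1 h1] := moment_measure_exists P1.
have [nu2 h2] := moment_measure_exists P2.
exists (laplace ab), (laplace ba), nu1, nu2; split.
- by exists (fun x => (vee a b x)%:E); split => //; exact: laplace_ec.
- by exists (fun x => (vee b a x)%:E); split => //; exact: laplace_ec.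
rewrite /ET_ineq => H.
have T := transport_laplace_le h1 h2.
have k01 : 0 < k < 1 by lra.
have E1 := laplace_entropy ab k01; have E2 := laplace_entropy ba k01.
have lnE : ln (c * expR 1 ^+ 2) = ln c + 2.
  by rewrite lnM ?posrE ?exprn_gt0 ?expR_gt0// lnXn ?expR_gt0// expRK.
have := le_trans (leeD E1 E2) (le_trans H (leeD2l _ T)).
rewrite -/a lnE -!EFinD lee_fin.
have aE : a * (1 - k) = 1 by rewrite mulVf// gt_eqF//; lra.
have ak : a <= 1 + 2 * k.
  by rewrite -(ler_pM2r (_ : 0 < 1 - k)) ?aE; [nra|lra].
have : a ^+ 2 <= 1 + 6 * k by rewrite expr2; nra.
lra.
Qed.

End Sharpness.

Theorem theorem3p6 (R : realType) :
  [/\ ET1 (expR 1 : R),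
      - ln (expR 1 * expR 1 ^+ 2) = - 3 :> R
    & forall c : R, expR 1 < c ->
        exists eta1 eta2 nu1 nu2 : probability (measurableTypeR R) R,
          [/\ log_concave_ec eta1 nu1, log_concave_ec eta2 nu2
            & ~ ET_ineq c eta1 eta2 nu1 nu2]].
Proof.
split.
- exact: ET1_expR1.
- by rewrite -expRM_natl -expRD expRK; lra.
- exact: ET_ineq_fails.
Qed.
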